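(* Let $M$ be a smooth manifold and let $N \subset M$ be a locally compact subset. Suppose that $N$ is smoothly ambient homogeneous, i.e. for each two points $x, y \in N$ there exists a diffeomorphism $h : M \to M$ such that $h(x) = y$ and $h(N) = N$. Then $N$ is a smooth submanifold of $M$.
   Context: Throughout, ''smooth'' means ''differentiable'' (not necessarily continuously differentiable). Thus a smooth manifold $M$ (of dimension $m$, Hausdorff, second countable) is one whose transition maps are differentiable, and a diffeomorphism is a bijection that is differentiable and whose inverse is differentiable. The subset $N$ is locally compact in the subspace topology induced from $M$. $N$ is a smooth submanifold of $M$ if there is an integer $k$ with $0 \le k \le m$ such that every point of $N$ has an open neighborhood $U$ in $M$ and a diffeomorphism $\varphi$ (i.e. a differentiable bijection whose inverse is differentiable) from $U$ onto an open subset of $\mathbb{R}^m$ with $\varphi(U \cap N) = \varphi(U) \cap (\mathbb{R}^k \times \{0\})$. No boundary is allowed, and $N$ is not required to be closed in $M$. *)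

(* Defs.v *)
From HB Require Import structures.
From mathcomp Require Import all_boot all_order all_algebra.
From mathcomp Require Import all_classical all_reals all_analysis.
Set Implicit Arguments.
Unset Strict Implicit.
Unset Printing Implicit Defensive.
Import Order.TTheory GRing.Theory Num.Theory.
Import numFieldNormedType.Exports.
Local Open Scope classical_set_scope.
Local Open Scope ring_scope.

(* A homeomorphism from an open subset of T onto an open subset of R^m.  Both
   [chart_map] and [chart_inv] are total functions, whose values outside of
   [chart_dom] and its image are irrelevant.  (If T is empty it has no charts,
   and its only atlas is the empty one.) *)
Record chart (R : realType) (T : topologicalType) (m : nat) := Chart {
  chart_dom : set T ;
  chart_map : T -> 'rV[R]_m ;
  chart_inv : 'rV[R]_m -> T ;
  chart_dom_open : open chart_dom ;
  chart_img_open : open (chart_map @` chart_dom) ;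
  chart_mapK : {in chart_dom, cancel chart_map chart_inv} ;
  chart_map_continuous : {in chart_dom, continuous chart_map} ;
  chart_inv_continuous : {in chart_map @` chart_dom, continuous chart_inv}
}.

(* "Smooth" means differentiable (not necessarily C^1) throughout. *)
Definition smooth_atlas (R : realType) (T : topologicalType) (m : nat)
    (A : set (chart R T m)) : Prop :=
  (forall x, exists2 c, A c & chart_dom c x) /\
  (forall c d x, A c -> A d -> chart_dom c x -> chart_dom d x ->
     differentiable (chart_map d \o chart_inv c) (chart_map c x)).

Record smooth_manifold (R : realType) (m : nat) := SmoothManifold {
  carrier :> topologicalType ;
  manifold_hausdorff : hausdorff_space carrier ;
  manifold_second_countable : @second_countable carrier ;
  atlas : set (chart R carrier m) ;
  atlas_smooth : smooth_atlas atlas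
}.
Arguments atlas {R m} M : rename.

Section EuclideanSpace.
Variables (R : realType) (m : nat).

Let id_open : open (id @` [set: 'rV[R]_m]).
Proof. by rewrite image_id; exact: openT. Qed.

Let id_cancel : {in [set: 'rV[R]_m], cancel id id}.
Proof. by []. Qed.

Let id_continuous (D : set 'rV[R]_m) : {in D, continuous (@id 'rV[R]_m)}.
Proof. by move=> x _; exact: cvg_id. Qed.

Definition euclidean_chart : chart R 'rV[R]_m m :=
  Chart openT id_open id_cancel (id_continuous (D := _))
    (id_continuous (D := _)).

Definition euclidean_atlas : set (chart R 'rV[R]_m m) := [set euclidean_chart].

Lemma euclidean_atlas_smooth : smooth_atlas euclidean_atlas.
Proof.
split=> [x|c d x -> -> _ _]; first by exists euclidean_chart.
exact: (@ex_diff _ _ _ _ _ id).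
Qed.

End EuclideanSpace.

(* Continuity is required separately because the coordinate expression involves
   the irrelevant values of [chart_map c'] at points that f sends outside of
   [chart_dom c']. *)
Definition smooth_at (R : realType) (T T' : topologicalType) (m m' : nat)
    (A : set (chart R T m)) (A' : set (chart R T' m'))
    (f : T -> T') (x : T) : Prop :=
  {for x, continuous f} /\
  (forall c c', A c -> A' c' -> chart_dom c x -> chart_dom c' (f x) ->
     differentiable (chart_map c' \o f \o chart_inv c) (chart_map c x)).

(* The restriction of f is a diffeomorphism from U onto V; meaningful for U and
   V open.  The values of f outside of U, and of g outside of V, are
   irrelevant. *)
Definition diffeomorphism (R : realType) (T T' : topologicalType) (m m' : nat)
    (A : set (chart R T m)) (A' : set (chart R T' m'))
    (U : set T) (V : set T') (f : T -> T') : Prop :=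
  [/\ set_bij U V f,
      forall x, U x -> smooth_at A A' f x
    & exists2 g : T' -> T,
        {in U, cancel f g} & forall y, V y -> smooth_at A' A g y].

(* R^k x {0} in R^m. *)
Definition coordinate_subspace (R : realType) (m k : nat) : set 'rV[R]_m :=
  [set v | forall i : 'I_m, (k <= i)%N -> v ord0 i = 0].

Definition smooth_submanifold (R : realType) (m : nat)
    (M : smooth_manifold R m) (N : set M) : Prop :=
  exists2 k : nat, (k <= m)%N &
    forall x, N x -> exists (U : set M) (phi : M -> 'rV[R]_m),
      [/\ open_nbhs x U,
          open (phi @` U),
          diffeomorphism (atlas M) (@euclidean_atlas R m) U (phi @` U) phi
        & phi @` (U `&` N) = phi @` U `&` @coordinate_subspace R m k].

Definition smoothly_ambient_homogeneous (R : realType) (m : nat)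
    (M : smooth_manifold R m) (N : set M) : Prop :=
  forall x y, N x -> N y -> exists h : M -> M,
    [/\ diffeomorphism (atlas M) (atlas M) setT setT h,
        h x = y
      & h @` N = N].

(* The library's [locally_compact N], for a set N in an ambient space, only asks
   for compact neighborhoods in the ambient space, which need not be contained
   in N, so that it holds for every subset of a manifold.  Local compactness of N
   in the induced topology is that of N as a space, i.e. of the type of elements
   of N with its subspace topology. *)
Definition locally_compact_subset (T : topologicalType) (N : set T) : Prop :=
  locally_compact [set: set_type N].

(* Main.v *)
Require Import Defs.
From HB Require Import structures.
From mathcomp Require Import all_boot all_order all_algebra.
From mathcomp Require Import all_classical all_reals all_analysis.
From mathcomp Require Import measurable_realfun ring lra.
Set Implicit Arguments.
Unset Strict Implicit.
Unset Printing Implicit Defensive.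
Import Order.TTheory GRing.Theory Num.Theory.
Import numFieldNormedType.Exports.
Local Open Scope classical_set_scope.
Local Open Scope ring_scope.

(* In a chart, N becomes a locally compact subset X of R^m, and a
   diffeomorphism of M that preserves N maps the contingent cones of X linearly
   onto each other, by the mere differentiability at one point.  A Baire
   category argument gives a point x at which every paratangent vector is
   tangent.  Let p be a linear map to R^k, with k minimal, that is injective on
   the contingent cone at x, hence on the paratangent cone: near x it is
   injective on X with a Lipschitz inverse s.  If p(X) were not a neighborhood
   of p(x), a ball of the complement of p(X) would touch p(X), and the cone at
   the touching point would project into a half-space; at x the paratangent
   cone is symmetric, so the cone would project into a hyperplane, against the
   minimality of k.  So X is a Lipschitz graph near x.  By Lebesgue's theorem on
   lines and Fubini's theorem, s has all its partial derivatives at some point,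
   where the cone therefore contains a single line above each axis.  By
   homogeneity so does the cone at x, which is linear because it is also the
   paratangent cone.  Hence all cones near x are k-dimensional linear subspaces,
   s is differentiable, and its graph can be flattened.  Finally homogeneity
   carries this flattening to every point of N. *)

(** The obstacle is that the derivative of a homogeneity map exists at each point without being
    continuous. Paratangent cones and Lipschitz bounds on [X], which involve pairs of moving points,
    are therefore not transported; contingent cones are. Uniform information is available at the
    generic point [x] only, and it reaches another point in two ways: through an estimate valid on a
    whole neighborhood of [x], or through the linear isomorphism between its cone and the cone at
    [x]. The number [k] cannot be defined as the dimension of a cone, since linearity of the cone is
    proved only after [k] has been used; hence the minimality among linear maps with trivial kernel
    on the cone. As derivatives may jump, the flattening is built together with an explicit
    inverse. *)

(** * Sup norm estimates for row vectors *)

Lemma rV_coord_le_norm (R : realType) (m : nat) (v : 'rV[R]_m) (j : 'I_m) :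
  `|v ord0 j| <= `|v|.
Proof.
rewrite [leRHS]/Num.norm /= mx_normrE.
by apply/bigmax_geP; right => /=; exists (ord0, j).
Qed.

Lemma rV_norm_leP (R : realType) (m : nat) (v : 'rV[R]_m) (c : R) : 0 <= c ->
  (forall j, `|v ord0 j| <= c) -> `|v| <= c.
Proof.
move=> c0 vc; rewrite [leLHS]/Num.norm /= mx_normrE; apply/bigmax_leP; split => //.
by move=> [i j] _ /=; rewrite ord1.
Qed.

Lemma rV_norm_ltP (R : realType) (m : nat) (v : 'rV[R]_m) (c : R) : 0 < c ->
  (forall j, `|v ord0 j| < c) -> `|v| < c.
Proof.
move=> c0 vc; rewrite [ltLHS]/Num.norm /= mx_normrE; apply/bigmax_ltP; split => //.
by move=> [i j] _ /=; rewrite ord1.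
Qed.

Lemma mulmx_norm_bound (R : realType) (m n : nat) (A : 'M[R]_(m, n)) :
  exists2 C, 0 < C & forall v : 'rV_m, `|v *m A| <= C * `|v|.
Proof.
(* The [+ 1] keeps the constant positive when [A = 0], as later estimates divide by it. *)
exists (\sum_i \sum_j `|A i j| + 1).
  by rewrite ltr_wpDl// sumr_ge0// => i _; rewrite sumr_ge0.
move=> v; apply: rV_norm_leP => [|j].
  by rewrite mulr_ge0// addr_ge0// sumr_ge0// => i _; rewrite sumr_ge0.
rewrite mxE; apply: le_trans (ler_norm_sum _ _ _) _.
rewrite mulrDl mul1r mulr_suml; apply: ler_wpDr => //.
apply: ler_sum => i _; rewrite normrM mulrC ler_pM//; last exact: rV_coord_le_norm.
by rewrite (bigD1 j)//= lerDl sumr_ge0.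
Qed.

Lemma norm_delta_mx (R : realType) (m : nat) (i : 'I_m) :
  `|delta_mx ord0 i : 'rV[R]_m| = 1.
Proof.
apply/eqP; rewrite eq_le; apply/andP; split.
  by apply: rV_norm_leP => // j; rewrite mxE/=; case: (_ == _);
    rewrite ?normr1 ?normr0.
by have := rV_coord_le_norm (delta_mx ord0 i : 'rV[R]_m) i;
  rewrite mxE !eqxx normr1.
Qed.

Lemma lipschitz_continuous (R : realType) (V W : normedModType R) (C : R)
    (F : V -> W) :
  (forall a b, `|F a - F b| <= C * `|a - b|) -> continuous F.
Proof.
move=> FC x; apply/cvgrPdist_le => e e0.
have D0 : 0 < `|C| + 1 by rewrite ltr_wpDl.
apply/nbhs_normP; exists (e / (`|C| + 1)) => /= [|y xy]; first exact: divr_gt0.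
apply: (le_trans (FC x y)); apply: (@le_trans _ _ ((`|C| + 1) * `|x - y|)).
  by rewrite ler_wpM2r// (le_trans (ler_norm _))// lerDl.
by rewrite mulrC -ler_pdivlMr// ltW.
Qed.

(** * Partial derivatives of Lipschitz functions *)

Lemma stieltjes_itv (R : realType) (F : cumulative R R) (a b : R) : a <= b ->
  lebesgue_stieltjes_measure F `]a, b]%classic = (F b - F a)%:E.
Proof.
move=> ab; rewrite /lebesgue_stieltjes_measure /measure_extension.
by rewrite measurable_mu_extE/=; [rewrite wlength_itv_bnd|exact: is_ocitv].
Qed.

Section lipschitz_stieltjes.
Variables (R : realType) (C : R) (F : cumulative R R).
Hypothesis C0 : 0 <= C.
Hypothesis F_lip : forall x y, x <= y -> F y - F x <= C * (y - x).

Let G (x : R) : R := C * x - F x.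

Let G_nd : nondecreasing G.
Proof. by move=> x y xy; rewrite /G; have := F_lip xy; lra. Qed.

Let F_lip' x y : `|F x - F y| <= C * `|x - y|.
Proof.
wlog : x y / x <= y => [h|xy].
  have [/h//|/ltW/h] := leP x y; by rewrite distrC (distrC y).
rewrite !ler0_norm ?subr_le0//; last exact: cumulative_is_nondecreasing.
by rewrite !opprB; exact: F_lip.
Qed.

Let G_rc : right_continuous G.
Proof.
apply: right_continuousW => x; apply: cvgB; first exact: cvgMr.
exact: (lipschitz_continuous F_lip').
Qed.

HB.instance Definition _ := isCumulative.Build R _ R G G_nd G_rc.

Let H (x : R) : R := C * x.
Let H_nd : nondecreasing H.
Proof. by move=> x y xy; rewrite /H ler_wpM2l. Qed.
Let H_rc : right_continuous H.
Proof. by apply: right_continuousW => x; exact: cvgMr. Qed.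
HB.instance Definition _ := isCumulative.Build R _ R H H_nd H_rc.

(* [F] and [C x - F x] are both nondecreasing and add up to [C x], so that the
   Stieltjes measure of [F] is at most [C] times the Lebesgue measure. *)
Lemma stieltjes_le_lebesgue (A : set R) : measurable A ->
  (lebesgue_stieltjes_measure F A <= C%:E * lebesgue_measure A)%E.
Proof.
move=> mA.
have HE : lebesgue_stieltjes_measure (H : cumulative R R) A =
          mscale (NngNum C0) lebesgue_measure A.
  apply: lebesgue_stieltjes_measure_unique => // X [[a b]] _ <- /=.
  have [ab|ba] := leP a b.
    rewrite stieltjes_itv// /mscale/= /lebesgue_measure stieltjes_itv//=.
    by rewrite -EFinM /H mulrBr.
  by rewrite set_itv_ge ?measure0// bnd_simp -leNgt ltW.
have HE2 : lebesgue_stieltjes_measure (H : cumulative R R) A =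
  measure_add (lebesgue_stieltjes_measure F)
              (lebesgue_stieltjes_measure (G : cumulative R R)) A.
  apply: lebesgue_stieltjes_measure_unique => // X [[a b]] _ <-.
  have [ab|ba] := leP a b.
    transitivity (lebesgue_stieltjes_measure F `]a, b]%classic +
      lebesgue_stieltjes_measure (G : cumulative R R) `]a, b]%classic)%E.
      rewrite (stieltjes_itv (H : cumulative R R) ab) (stieltjes_itv F ab).
      rewrite (stieltjes_itv (G : cumulative R R) ab) -EFinD.
      by congr EFin; rewrite /= /H /G; ring.
    by rewrite -measure_addE.
  by rewrite set_itv_ge ?measure0// bnd_simp -leNgt ltW.
have -> : (C%:E * lebesgue_measure A)%E = mscale (NngNum C0) lebesgue_measure A.
  by [].
by rewrite -HE HE2 measure_addE leeDl.
Qed.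

End lipschitz_stieltjes.

(** The Stieltjes measure of [F] is absolutely continuous, so by Radon-Nikodym [F] is, up to a
    constant, the integral of a density, and Lebesgue differentiation applies. The interval is an
    open neighborhood of the unit interval, which carries the uniform measures used below. *)
Lemma lipschitz_cumulative_ae_derivable (R : realType) (C : R)
    (F : cumulative R R) : 0 <= C ->
  (forall x y, x <= y -> F y - F x <= C * (y - x)) ->
  {ae lebesgue_measure, forall x, x \in `]-1, 2[ -> derivable F x 1}.
Proof.
move=> C0 FC; pose mu : {sigma_finite_measure set (measurableTypeR R) -> \bar R} :=
  @lebesgue_measure R.
pose D : set (measurableTypeR R) := `]-1, 2]%classic.
have mD : measurable D by exact: measurable_itv.
pose nuF : {measure set (measurableTypeR R) -> \bar R} :=
  lebesgue_stieltjes_measure F.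
have nuD : (nuF D < +oo)%E by rewrite /nuF/= /D stieltjes_itv ?ltry//; lra.
(* Cutting down to [D] makes the measure finite, so that the density is integrable on the whole
   line. *)
pose nu : {finite_measure set (measurableTypeR R) -> \bar R} := mfrestr mD nuD.
have nu_mu : nu `<< mu.
  apply/null_content_dominatesP => A mA muA0.
  apply/eqP; rewrite eq_le measure_ge0 andbT.
  rewrite /nu/= /mfrestr /mrestr.
  apply: (@le_trans _ _ (nuF A)).
    by apply: le_measure; rewrite ?inE//; exact: measurableI.
  by apply: le_trans (stieltjes_le_lebesgue C0 FC mA) _; rewrite muA0 mule0.
have [f [fge0 ffin fint fE]] := radon_nikodym_sigma_finite nu_mu.
pose f' := fine \o f.
have ff' : EFin \o f' = f by apply/funext => x /=; rewrite /f' /= fineK.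
have int' : mu.-integrable setT (EFin \o f') by rewrite ff'.
have := @FTC1 R f' (BRight (-1)).
case.
- by move=> y; apply: integrableS int' => //; exact: measurable_itv.
- by apply: open_integrable_locally => //; exact: openT.
move=> N [mN N0 NE]; exists N; split => //.
apply: subset_trans NE; apply: subsetC => x /= FTCx.
rewrite in_itv/= => /andP[x1 x2].
have [] := FTCx x1; set Phi := (X in derivable X) => Phid _.
have PhiE y : -1 <= y -> y <= 2 -> Phi y = F y - F (-1).
  move=> y1 y2; rewrite /Phi /Rintegral.
  rewrite -[X in integral _ _ X]/(EFin \o f') ff' -(fE `]-1, y]%classic);
    last exact: measurable_itv.
  rewrite /nu/= /mfrestr /mrestr.
  have -> : `]-1, y]%classic `&` D = `]-1, y]%classic.
    apply/seteqP; split=> [z []//|z /=].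
    by rewrite /D /= !in_itv/= => /andP[-> zy]; rewrite zy (le_trans zy).
  by rewrite /nuF stieltjes_itv.
(* The formula [PhiE] holds on [[-1, 2]] only, hence an equality near [x]. *)
have : derivable (fun y => Phi y + cst (F (-1)) y) x 1 by exact: derivableD.
apply: near_eq_derivable.
near=> y; rewrite PhiE ?subrK//.
- by apply/ltW; near: y; exact: lt_nbhsr.
- by apply/ltW; near: y; exact: lt_nbhsl.
Unshelve. all: by end_near. Qed.

(** Adding [C * x] makes a [C]-Lipschitz function nondecreasing, and [C + C] bounds its slopes. *)
Lemma lipschitz_ae_derivable (R : realType) (C : R) (g : R -> R) :
  (forall x y, `|g x - g y| <= C * `|x - y|) ->
  {ae lebesgue_measure, forall x, x \in `]-1, 2[ -> derivable g x 1}.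
Proof.
move=> gC; have C0 : 0 <= C.
  by have := gC 1 0; rewrite subr0 normr1 mulr1; exact: le_trans.
pose F x : R := g x + C * x.
have F_nd : nondecreasing F.
  move=> x y xy; have := gC x y; rewrite /F [`|x - y|]ler0_norm ?subr_le0//.
  by rewrite ler_norml => /andP[_]; lra.
have F_rc : right_continuous F.
  apply: right_continuousW => x; apply: cvgD; last exact: cvgMr.
  exact: (lipschitz_continuous gC).
pose FC := HB.pack_for (cumulative R R) F
  (isCumulative.Build R _ R F F_nd F_rc).
have := @lipschitz_cumulative_ae_derivable R (C + C) FC.
case.
- exact: addr_ge0.
- move=> x y xy; have := gC y x; rewrite /= /F [`|y - x|]ger0_norm ?subr_ge0//.
  by rewrite ler_norml => /andP[_]; lra.
move=> N [mN N0 NE]; exists N; split => //.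
apply: subset_trans NE; apply: subsetC => x /= Fd x12.
have -> : g = (fun y => F y - C * y) by apply/funext => y; rewrite /F addrK.
apply: derivableB; first exact: Fd.
by apply: derivableM => //; exact: derivable_cst.
Qed.

(* The last clause is Tonelli's theorem: a measurable set that meets every line
   parallel to a coordinate axis in a null set is null. *)
Lemma product_uniform_space (R : realType) (k : nat) :
  exists (d : measure_display) (T : measurableType d) (P : probability T R)
    (x : 'I_k -> T -> R) (upd : 'I_k -> T -> R -> T),
  [/\ forall i, measurable_fun setT (x i),
      forall i j t s, x j (upd i t s) = if j == i then s else x j t
    & forall i B, measurable B ->
        (forall t,
          (uniform_prob (@ltr01 R)).-negligible [set s | B (upd i t s)]) ->
        P B = 0%E].
Proof.
elim: k => [|k [d [T [P [x [upd [mx xupd null]]]]]]].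
  exists _, unit, \d_tt, (fun _ _ => 0), (fun _ t _ => t).
  by split=> -[].
pose U : probability (measurableTypeR R) R := uniform_prob (@ltr01 R).
pose x' (i : 'I_k.+1) (p : measurableTypeR R * T) : R :=
  if unlift ord0 i is Some j then x j p.2 else p.1.
pose upd' (i : 'I_k.+1) (p : measurableTypeR R * T) (s : R) :
    measurableTypeR R * T :=
  if unlift ord0 i is Some j then (p.1, upd j p.2 s) else (s, p.2).
exists _, _, ((U \x P)%E : probability _ _), x', upd'; split.
- move=> i; rewrite /x'; case: unliftP => [j _|_].
    by apply: measurableT_comp => //; exact: mx.
  exact: measurable_fst.
- move=> i j t s; rewrite /x' /upd'.
  case: (unliftP ord0 i) => [i'|] ->; case: (unliftP ord0 j) => [j'|] -> //=.
- move=> i B mB; rewrite /upd'; case: unliftP => [j|] _ B0.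
    apply: integral0_eq => r _ /=; apply: (null j).
      exact: measurable_xsection.
    move=> t; have := B0 (r, t); congr (negligible _ _).
    by apply/seteqP; split=> s /=; rewrite /xsection /= inE.
  (* For the first coordinate the order of integration is exchanged, so that the inner integral runs
     along the line in question. *)
  transitivity (\int[U]_r fubini_F P (EFin \o \1_B) r)%E.
    by apply: eq_integral => r _; rewrite indic_fubini_tonelli_FE.
  rewrite indic_fubini_tonelli//; apply: integral0_eq => t _.
  rewrite indic_fubini_tonelli_GE//=.
  apply: measure_negligible; first exact: measurable_ysection.
  have := B0 (0, t); congr (negligible _ _).
  by apply/seteqP; split=> s /=; rewrite /ysection /= inE.
Qed.

(** The left side quantifies over rationals and integers only, so that it defines a measurable set
    when [phi] depends measurably on a parameter. *)
Lemma approx_derivativeP (R : realType) (phi : R -> R) : continuous phi ->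
  (forall n, exists (q : rat) (N : nat), forall r : rat,
     `|ratr r : R| < N.+1%:R^-1 ->
     `|phi (ratr r) - phi 0 - ratr r * ratr q| <= n.+1%:R^-1 * `|ratr r|) <->
  (exists l : R, forall e : R, 0 < e -> exists2 d : R, 0 < d &
     forall h : R, `|h| < d -> `|phi h - phi 0 - h * l| <= e * `|h|).
Proof.
move=> cphi; split=> [H|[l H] n]; last first.
  have n0 : 0 < n.+1%:R^-1 / 2 :> R by rewrite divr_gt0// invr_gt0.
  have [d d0 dl] := H _ n0.
  have : l - n.+1%:R^-1 / 2 < l + n.+1%:R^-1 / 2 by rewrite ltrD2l gtrN.
  move=> /rat_in_itvoo[q].
  rewrite in_itv/= => /andP[q1 q2].
  have [N Nd] : exists N : nat, N.+1%:R^-1 < d.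
    exists (Num.truncn d^-1); rewrite invf_plt ?posrE//.
    by apply: truncnS_gt.
  exists q, N => r /lt_trans/(_ Nd)/dl {}dl.
  have -> : phi (ratr r) - phi 0 - ratr r * ratr q =
    (phi (ratr r) - phi 0 - ratr r * l) + ratr r * (l - ratr q) by ring.
  rewrite (le_trans (ler_normD _ _))// [X in _ <= X * _]splitr mulrDl lerD//.
  rewrite normrM mulrC ler_wpM2r// ler_norml.
  move: q1 q2; set a : R := _ / 2 => q1 q2.
  by clear -q1 q2; apply/andP; split; lra.
have [q Hq] := choice H; have [N HN] := choice Hq.
(* A strict failure at a real [h] would persist, by continuity of [phi], at a nearby rational. *)
have real n h : `|h| < (N n).+1%:R^-1 ->
    `|phi h - phi 0 - h * ratr (q n)| <= n.+1%:R^-1 * `|h|.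
  move=> hN; rewrite leNgt; apply/negP => bad.
  pose psi x := `|phi x - phi 0 - x * ratr (q n)| - n.+1%:R^-1 * `|x|.
  have cpsi : continuous psi.
    move=> x; apply: cvgB; last by apply: cvgMr; exact: norm_continuous.
    apply: cvg_norm; apply: cvgB; last by apply: cvgMl.
    by apply: cvgB; [exact: cphi|exact: cvg_cst].
  have : nbhs h ([set x | 0 < psi x] `&` [set x | `|x| < (N n).+1%:R^-1]).
    apply: filterI.
      by apply: (cvgr_gt (psi h) (cpsi h)); rewrite subr_gt0.
    exact: (cvgr_lt `|h| (@norm_continuous _ R h)).
  rewrite nbhsE => -[V [oV Vh] Vsub].
  case: (dense_rat (ex_intro _ h Vh) oV) => r [rV [r' _ r'E]].
  by have [] := Vsub r rV; rewrite /= -r'E => r1 /HN; rewrite -subr_le0 leNgt r1.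
(* Testing two estimates at the same small [h > 0] shows that the intervals of radius [1/(n+1)]
   around the [q n] meet pairwise. The supremum of their left ends lies in all of them and is the
   derivative. *)
pose lo (n : nat) : R := ratr (q n) - n.+1%:R^-1.
have lo_ub n p : lo n <= ratr (q p) + p.+1%:R^-1.
  rewrite /lo; have M0 : 0 < (Num.min (N n).+1%:R^-1 (N p).+1%:R^-1 : R).
    by rewrite lt_min !invr_gt0 !ltr0n.
  set M := Num.min _ _ in M0.
  pose h : R := M / 2; have h0 : 0 < h by rewrite divr_gt0.
  have hM : `|h| < M by rewrite gtr0_norm// /h; lra.
  have := real n h (lt_le_trans hM _); rewrite ge_min lexx => /(_ erefl).
  have := real p h (lt_le_trans hM _); rewrite ge_min lexx orbT => /(_ erefl).
  rewrite (gtr0_norm h0) !ler_norml => /andP[p1 p2] /andP[n1 n2].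
  rewrite -(ler_pM2l h0); clear -p1 p2 n1 n2.
  move: p1 p2 n1 n2; set a : R := _^-1; set b : R := _^-1 => p1 p2 n1 n2.
  lra.
have sup_lo : has_sup (range lo).
  split; first by exists (lo 0); exists 0.
  by exists (ratr (q 0%N) + 1%:R^-1) => _ [n _ <-]; exact: lo_ub.
exists (sup (range lo)) => e e0.
have [n ne] : exists n : nat, n.+1%:R^-1 < e / 2.
  exists (Num.truncn (e / 2)^-1); rewrite invf_plt ?posrE ?divr_gt0//.
  exact: truncnS_gt.
exists (N n).+1%:R^-1; first by rewrite invr_gt0.
move=> h /real rh.
have s1 : lo n <= sup (range lo) by apply: ub_le_sup; [case: sup_lo|exists n].
have s2 : sup (range lo) <= ratr (q n) + n.+1%:R^-1.
  by apply: ge_sup; [case: sup_lo|move=> _ [p _ <-]].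
have -> : phi h - phi 0 - h * sup (range lo) =
  (phi h - phi 0 - h * ratr (q n)) + h * (ratr (q n) - sup (range lo)) by ring.
rewrite (le_trans (ler_normD _ _))// [X in _ <= X * _]splitr mulrDl lerD//.
  by rewrite (le_trans rh)// ler_wpM2r// ltW.
rewrite normrM mulrC ler_wpM2r//; apply: le_trans (ltW ne).
move: s1 s2; rewrite ler_norml /lo; set a : R := _^-1; set b : R := sup _.
by move=> s1 s2; clear -s1 s2; apply/andP; split; lra.
Qed.

Lemma derivable_approx (R : realType) (g : R -> R) (s : R) : derivable g s 1 ->
  exists l : R, forall e : R, 0 < e -> exists2 d : R, 0 < d &
     forall h : R, `|h| < d -> `|g (s + h) - g s - h * l| <= e * `|h|.
Proof.
move=> /cvg_ex[l gl]; exists l => e e0.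
have /cvgrPdist_le/(_ e e0) := gl.
rewrite /dnbhs /= => -[d /= d0 dE]; exists d => // h hd.
have [->|h0] := eqVneq h 0; first by rewrite addr0 subrr mul0r subr0 normr0 mulr0.
have := dE h; rewrite /= sub0r normrN => /(_ hd h0).
rewrite -[h *: _]/(h * 1) mulr1 => H.
have -> : g (s + h) - g s - h * l = - h * (l - h^-1 *: (g (h + s) - g s)).
  rewrite (addrC s) -[h^-1 *: _]/(h^-1 * _) mulrBr [- h * (_ * _)]mulrA mulNr.
  by rewrite [- h * h^-1]mulNr divff//; ring.
by rewrite normrM normrN mulrC ler_wpM2r.
Qed.

(** The open set where [a < G v] is the union of the countably many rational boxes that it contains,
    and the preimage of a box is a finite intersection of preimages of intervals. *)
Lemma measurable_rV_comp (R : realType) (d : measure_display)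
    (T : measurableType d) (k : nat) (x : 'I_k -> T -> R) (G : 'rV[R]_k -> R) :
  (forall i, measurable_fun setT (x i)) -> continuous G ->
  measurable_fun setT (fun t => G (\row_i x i t)).
Proof.
move=> mx cG; apply: (measurability _ (RGenOInfty.measurableE R)).
move=> /= _ [_ [a ->] <-]; rewrite setTI.
pose box (c : 'rV[rat]_k * nat) : set 'rV[R]_k :=
  [set v | forall i, `|v ord0 i - ratr (c.1 ord0 i)| < c.2.+1%:R^-1].
pose W := [set v : 'rV[R]_k | a < G v].
have oW : open W.
  apply: (@open_comp _ _ G [set y | a < y]); last exact: open_gt.
  by move=> v _; exact: cG.
have WE : W = \bigcup_(c in [set c | box c `<=` W]) box c.
  apply/seteqP; split=> [v Wv|v [c cW]]; last exact: cW.
  have [e e0 eW] : exists2 e : R, 0 < e & forall w, `|v - w| < e -> W w.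
    have /nbhs_ballP[e e0 eW] := open_nbhs_nbhs (conj oW Wv).
    by exists e => // w vw; apply: eW; rewrite -ball_normE.
  have [n ne] : exists n : nat, n.+1%:R^-1 < e / 2.
    exists (Num.truncn (e / 2)^-1); rewrite invf_plt ?posrE ?divr_gt0//.
    exact: truncnS_gt.
  have n0 : 0 < n.+1%:R^-1 :> R by rewrite invr_gt0.
  have /choice[q Hq] : forall i, exists q : rat,
      `|v ord0 i - ratr q| < n.+1%:R^-1.
    move=> i.
    have /rat_in_itvoo[q] : v ord0 i < v ord0 i + n.+1%:R^-1 by rewrite ltrDl.
    rewrite in_itv/= => /andP[q1 q2]; exists q.
    by rewrite distrC gtr0_norm ?subr_gt0// ltrBlDl.
  exists (\row_i q i, n) => /=; last by move=> i /=; rewrite mxE.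
  move=> w wb; apply: eW; apply: rV_norm_ltP => // i; rewrite !mxE.
  have := wb i; rewrite /= mxE => wi; have := Hq i.
  move: wi ne; clear; set b : R := n.+1%:R^-1; rewrite !ltr_norml.
  by move=> /andP[? ?] ? /andP[? ?]; apply/andP; split; lra.
have -> : (fun t => G (\row_i x i t)) @^-1` `]a, +oo[ =
    \bigcup_(c in [set c | box c `<=` W])
       \bigcap_(i in [set: 'I_k])
         (x i @^-1` ball (ratr (c.1 ord0 i) : R) (c.2.+1%:R^-1)).
  apply/seteqP; split=> t.
    rewrite /= in_itv/= andbT => /= Gt.
    have : W (\row_i x i t) by [].
    rewrite {1}WE => -[c cW cb]; exists c => // i _ /=.
    by rewrite -ball_normE /= distrC; have := cb i; rewrite mxE.
  move=> [c cW cb]; rewrite /= in_itv/= andbT.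
  apply: (cW (\row_i x i t)) => i; rewrite mxE distrC.
  by have := cb i Logic.I; rewrite -ball_normE.
rewrite bigcup_mkcond; apply: countable_bigcupT_measurable => // c.
case: ifPn => // _.
apply: fin_bigcap_measurable => // i _.
by rewrite -[X in measurable X]setTI; apply: mx => //; exact: measurable_ball.
Qed.

Lemma uniform_prob_outside (R : realType) :
  (uniform_prob (@ltr01 R)).-negligible (~` `[0, 1]%classic).
Proof.
apply/negligibleP; first by apply: measurableC; exact: measurable_itv.
apply: integral0_eq => x /= /negP; rewrite in_itv /= /uniform_pdf.
by move=> /negbTE ->.
Qed.

(** For fixed [i] and [j] the bad points on each line parallel to the axis form a null set, hence so
    do all bad points, and finitely many null sets do not fill a probability space. Having [a] in
    the unit cube lets the lemma be applied, after rescaling, to a function given on a ball. *)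
Lemma lipschitz_has_partials (R : realType) (k m : nat) (C : R)
    (F : 'rV[R]_k -> 'rV[R]_m) :
  (forall a b, `|F a - F b| <= C * `|a - b|) ->
  exists2 a : 'rV[R]_k, forall i, a ord0 i \in `[0, 1] &
    forall i j, exists l : R, forall e : R, 0 < e -> exists2 d : R, 0 < d &
      forall h : R, `|h| < d ->
        `|F (a + h *: delta_mx ord0 i) ord0 j - F a ord0 j - h * l| <= e * `|h|.
Proof.
move=> FC; have cF := lipschitz_continuous FC.
have [d [T [P [x [upd [mx xupd null]]]]]] := product_uniform_space R k.
pose X t : 'rV[R]_k := \row_i x i t.
pose phi i j t (h : R) := F (X t + h *: delta_mx ord0 i) ord0 j.
have phi0 i j t : phi i j t 0 = F (X t) ord0 j by rewrite /phi scale0r addr0.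
have phi_lip i j t h h' : `|phi i j t h - phi i j t h'| <= C * `|h - h'|.
  rewrite /phi -[F _ _ _ - _](_ : (F (X t + h *: delta_mx ord0 i) -
     F (X t + h' *: delta_mx ord0 i)) ord0 j = _); last by rewrite !mxE.
  apply: (le_trans (rV_coord_le_norm _ _)); apply: (le_trans (FC _ _)).
  by rewrite opprD addrACA subrr add0r -scalerBl normrZ norm_delta_mx mulr1.
pose good i j := [set t | forall n, exists (q : rat) (N : nat), forall r : rat,
     `|ratr r : R| < N.+1%:R^-1 ->
     `|phi i j t (ratr r) - phi i j t 0 - ratr r * ratr q| <=
        n.+1%:R^-1 * `|ratr r|].
have mgood i j : measurable (good i j).
  have -> : good i j = \bigcap_n \bigcup_(q : rat) \bigcup_(N : nat)
      \bigcap_(r in [set r : rat | `|ratr r : R| < N.+1%:R^-1])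
      [set t | `|phi i j t (ratr r) - phi i j t 0 - ratr r * ratr q| <=
        n.+1%:R^-1 * `|ratr r|].
    apply/seteqP; split=> [t h n _|t h n].
      by have [q [N H]] := h n; exists q => //; exists N.
    by have [q _ [N _ H]] := h n Logic.I; exists q, N.
  apply: bigcap_measurable => [|n _]; first by exists 0%N.
  apply: bigcupT_measurable_rat => q; apply: bigcupT_measurable => N.
  rewrite -[X in measurable X]setCK setC_bigcap; apply: measurableC.
  rewrite bigcup_mkcond; apply: bigcupT_measurable_rat => r.
  case: ifPn => // _; apply: measurableC.
  have mphi h : measurable_fun setT (fun t => phi i j t h).
    apply: (measurable_rV_comp
      (G := fun v => F (v + h *: delta_mx ord0 i) ord0 j)) => //.
    apply: (@lipschitz_continuous _ _ _ C) => v w.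
    rewrite -[F _ _ _ - _](_ : (F (v + h *: delta_mx ord0 i) -
      F (w + h *: delta_mx ord0 i)) ord0 j = _); last by rewrite !mxE.
    apply: (le_trans (rV_coord_le_norm _ _)); apply: (le_trans (FC _ _)).
    by rewrite opprD addrACA subrr addr0.
  rewrite -[X in measurable X]setTI.
  apply: measurable_fun_le => //.
  apply: measurableT_comp => //; apply: measurable_funB; last exact: measurable_cst.
  by apply: measurable_funB; exact: mphi.
have ae_good i j : {ae P, forall t, good i j t}.
  exists (~` good i j); split => //; first exact: measurableC.
  apply: (null i); first exact: measurableC.
  move=> t.
  have [N [mN N0 NE]] := lipschitz_ae_derivable (phi_lip i j (upd i t 0)).
  (* Along the line, [good] at [upd i t s] amounts to derivability at [s] of one fixed function. *)
  have phi_upd s h : phi i j (upd i t s) h = phi i j (upd i t 0) (s + h).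
    rewrite /phi; congr (F _ _ _); apply/rowP => p.
    by rewrite !mxE !xupd; case: (p == i) => /=; ring.
  have bad_null : [set s | (~` good i j) (upd i t s)] `<=`
      N `|` ~` `[0, 1]%classic.
    move=> s /= ngood; have [s01|] := boolP (s \in `[0, 1]%R); last first.
      by move=> /negP s01; right.
    have {}s01 : s \in `]-1, 2[.
      by move: s01; rewrite !in_itv/= => /andP[? ?]; apply/andP; split; lra.
    left; apply: NE => /= /(_ s01) dphi; apply: ngood.
    apply/approx_derivativeP.
      exact: (@lipschitz_continuous _ _ _ C).
    have [l Hl] := derivable_approx dphi; exists l => e /Hl[del del0 H].
    exists del => // h hd.
    by rewrite (phi_upd s h) (phi_upd s 0) addr0; exact: H.
  apply: (negligibleS (A := N `|` ~` `[0, 1]%classic)); first exact: bad_null.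
  apply: negligibleU.
    exists N; split => //.
    have /null_content_dominatesP := @dominates_uniform_prob R 0 1 ltr01.
    exact.
  exact: uniform_prob_outside.
have ae_box i : {ae P, forall t, x i t \in `[0, 1]}.
  have mbox : measurable [set t | x i t \in `[0, 1]].
    by have := mx i measurableT _ (measurable_itv `[0, 1]); rewrite setTI.
  exists (~` [set t | x i t \in `[0, 1]]); split => //; first exact: measurableC.
  apply: (null i); first exact: measurableC.
  move=> t; have -> : [set s | (~` [set t0 | x i t0 \in `[0, 1]]) (upd i t s)] =
      ~` `[0, 1]%classic by apply/seteqP; split=> s; rewrite /= xupd eqxx.
  exact: uniform_prob_outside.
have : {ae P, forall t, forall i, x i t \in `[0, 1] /\ forall j, good i j t}.
  apply: filter_forall => i.
  have good_i : {ae P, forall t, forall j, good i j t}.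
    by apply: filter_forall => j; exact: ae_good.
  by apply: filterS2 (ae_box i) good_i => t ? ?; split.
move=> [N [mN N0 NE]].
have [t Nt] : exists t, ~ N t.
  apply/not_existsP => NT.
  have : P setT = 0%E by rewrite -N0; congr (P _); apply/seteqP; split=> // t _;
    exact: contrapT (NT t).
  by rewrite probability_setT => -[/eqP]; rewrite oner_eq0.
have Ht : forall i, x i t \in `[0, 1] /\ forall j, good i j t.
  by apply: contrapT => /NE.
exists (X t) => [i|i j].
  by rewrite mxE; case: (Ht i).
have [_ /(_ j)] := Ht i.
rewrite -[good i j t]/(forall n, _) approx_derivativeP; last first.
  exact: (@lipschitz_continuous _ _ _ C).
by under eq_exists do rewrite phi0.
Qed.

(** * Tangent and paratangent cones *)

(** A cluster point of a sequence of points [s n] in [S (1/(n+1))] works, since monotonicity puts a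
    tail of the sequence in every [S e]. *)
Lemma compact_limit (R : realType) (V : normedModType R) (K : set V)
    (S : R -> set V) :
  compact K -> (forall e : R, 0 < e -> exists2 s, K s & S e s) ->
  (forall e e', e <= e' -> S e `<=` S e') ->
  exists2 v, K v & forall e, 0 < e -> exists2 s, S e s & `|s - v| < e.
Proof.
move=> cK KS mono.
have /choice[s Hs] : forall n, exists s, K s /\ S n.+1%:R^-1 s.
  by move=> n; have [//|s ? ?] := KS n.+1%:R^-1; exists s.
have Ks : \forall n \near \oo, K (s n).
  by apply: nearW => n; have [] := Hs n.
have [v [Kv cv]] := cK (s @ \oo) _ Ks; exists v => // e e0.
have Se : \forall n \near \oo, S e (s n).
  near=> n; have [_] := Hs n; apply: mono; apply/ltW.
  by near: n; exact: (near_infty_natSinv_lt (PosNum e0)).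
have [w [Sw]] := cv _ _ Se (nbhsx_ballx v e e0).
by rewrite -ball_normE /= distrC => vw; exists w.
Unshelve. all: by end_near. Qed.

Lemma unit_sphere_compact (R : realType) (m : nat) :
  compact [set v : 'rV[R]_m | `|v| = 1].
Proof.
apply: bounded_closed_compact.
  exists 1; split; first exact: num_real.
  by move=> M M1 v /= ->; exact: ltW.
rewrite (_ : [set _ | _] = (fun v : 'rV[R]_m => `|v|) @^-1` [set 1])//.
by apply: preimage_closed => [v _|]; [exact: norm_continuous|exact: closed_eq].
Qed.

(** One construction covers both cones: [S e] is the set of pairs allowed at scale [e], and [v] is a
    limit of nonnegative multiples of their differences. The same [e] serves as scale and as
    precision. *)
Definition dircone (R : realType) (m : nat) (S : R -> set ('rV[R]_m * 'rV[R]_m))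
    (v : 'rV[R]_m) : Prop :=
  forall e, 0 < e -> exists y z t,
    [/\ S e (y, z), 0 <= t & `|t *: (y - z) - v| < e].

Definition tangent_pairs (R : realType) (m : nat) (X : set 'rV[R]_m)
    (x : 'rV[R]_m) (e : R) : set ('rV[R]_m * 'rV[R]_m) :=
  [set p | [/\ X p.1, p.2 = x & `|p.1 - x| < e]].

Definition paratangent_pairs (R : realType) (m : nat) (X : set 'rV[R]_m)
    (x : 'rV[R]_m) (e : R) : set ('rV[R]_m * 'rV[R]_m) :=
  [set p | [/\ X p.1, X p.2, `|p.1 - x| < e & `|p.2 - x| < e]].

(* Bouligand's contingent cone, and the paratangent cone. *)
Notation tcone X x := (dircone (tangent_pairs X x)).
Notation pcone X x := (dircone (paratangent_pairs X x)).

Lemma tangent_pairs_mono (R : realType) (m : nat) (X : set 'rV[R]_m) x e e' :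
  e <= e' -> tangent_pairs X x e `<=` tangent_pairs X x e'.
Proof. by move=> ee' p [? ? h]; split => //; exact: lt_le_trans h _. Qed.

Lemma paratangent_pairs_mono (R : realType) (m : nat) (X : set 'rV[R]_m) x e e' :
  e <= e' -> paratangent_pairs X x e `<=` paratangent_pairs X x e'.
Proof.
move=> ee' p [? ? h1 h2].
by split => //; [exact: lt_le_trans h1 _|exact: lt_le_trans h2 _].
Qed.

Lemma tcone_pcone (R : realType) (m : nat) (X : set 'rV[R]_m) x v :
  X x -> tcone X x v -> pcone X x v.
Proof.
move=> Xx H e e0; have [y [z [t [[/= Xy -> yx] t0 yv]]]] := H e e0.
by exists y, x, t; split => //; split => //=; rewrite subrr normr0.
Qed.

(** Swapping the two points of a pair reverses the difference. The contingent cone has no such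
    symmetry, one of its points being fixed. *)
Lemma pconeN (R : realType) (m : nat) (X : set 'rV[R]_m) x v :
  pcone X x v -> pcone X x (- v).
Proof.
move=> H e e0; have [y [z [t [[/= Xy Xz yx zx] t0 yv]]]] := H e e0.
exists z, y, t; split => //.
by rewrite -(opprB y) scalerN -opprD normrN.
Qed.

(** Compactness of the unit sphere, applied to normalized differences; [D] carries along a property
    of these differences that is to be passed to the limiting direction. *)
Lemma dircone_limit (R : realType) (m : nat)
    (S : R -> set ('rV[R]_m * 'rV[R]_m)) (D : R -> set 'rV[R]_m) :
  (forall e e', e <= e' -> S e `<=` S e') ->
  (forall e e', e <= e' -> D e `<=` D e') ->
  (forall e : R, 0 < e -> exists y z,
     [/\ S e (y, z), y != z & D e (`|y - z|^-1 *: (y - z))]) ->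
  exists v, [/\ dircone S v, `|v| = 1 &
    forall e, 0 < e -> exists2 w, D e w & `|w - v| < e].
Proof.
move=> mS mD H.
pose T e : set 'rV[R]_m := [set v | D e v /\ exists y z,
  [/\ S e (y, z), y != z & v = `|y - z|^-1 *: (y - z)]].
have [||v v1 Hv] := @compact_limit _ _ _ T (@unit_sphere_compact R m).
- move=> e e0; have [y [z [Se yz De]]] := H e e0.
  exists (`|y - z|^-1 *: (y - z)); last by split => //; exists y, z.
  by rewrite /= normrZ normfV normr_id mulVf// normr_eq0 subr_eq0.
- move=> e e' ee' v [De [y [z [Se yz vE]]]]; split; first exact: mD De.
  by exists y, z; split => //; exact: mS Se.
exists v; split => // e e0; have [w [De [y [z [Se yz wE]]]] wv] := Hv e e0.
  by exists y, z, `|y - z|^-1; rewrite -wE; split.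
by exists w.
Qed.

(** A closed condition that fails for all unit vectors of the cone fails uniformly for secants at a
    small scale: otherwise offending secants would accumulate at an offending unit vector. *)
Lemma dircone_avoid (R : realType) (m : nat)
    (S : R -> set ('rV[R]_m * 'rV[R]_m)) (Z : set 'rV[R]_m) :
  (forall e e', e <= e' -> S e `<=` S e') -> closed Z ->
  (forall v, dircone S v -> `|v| = 1 -> ~ Z v) ->
  exists2 r, 0 < r & forall y z, S r (y, z) -> y != z ->
    ~ Z (`|y - z|^-1 *: (y - z)).
Proof.
move=> mS cZ H; apply: contrapT => /forall2NP nH.
have [//|||v [Sv v1 Zv]] := @dircone_limit _ _ S (fun=> Z).
- by move=> e e' _.
- move=> e e0; apply: contrapT => He; case: (nH e) => [/(_ e0)//|]; apply.
  by move=> y z Se yz Zyz; apply: He; exists y, z.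
apply: (H v) => //; apply: cZ => B /nbhs_ballP[e /= e0 eB].
have [w Zw wv] := Zv e e0; exists w; split => //; apply: eB.
by rewrite -ball_normE /= distrC.
Qed.

(** If no such bound held, normalized differences with arbitrarily small projections would
    accumulate at a unit vector of the cone in the kernel of [p]. For the paratangent cone, this is
    the Lipschitz inverse of the projection. *)
Lemma dircone_transversal (R : realType) (m k : nat)
    (S : R -> set ('rV[R]_m * 'rV[R]_m)) (p : 'M[R]_(m, k)) :
  (forall e e', e <= e' -> S e `<=` S e') ->
  (forall v, dircone S v -> v *m p = 0 -> v = 0) ->
  exists r c, [/\ 0 < r, 0 < c & forall y z, S r (y, z) ->
    `|y - z| <= c * `|y *m p - z *m p|].
Proof.
move=> mS H; apply: contrapT => nH.
have [C C0 pC] := mulmx_norm_bound p.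
have [//|||v [Sv v1 Dv]] :=
    @dircone_limit _ _ S (fun e => [set v | `|v *m p| <= e]).
- by move=> e e' ee' v /= /le_trans; exact.
- move=> e e0; apply: contrapT => He; apply: nH; exists e, e^-1.
  split; rewrite ?invr_gt0// => y z Se; rewrite leNgt; apply/negP => bad.
  apply: He; exists y, z; split => //.
    by apply: contraTneq bad => ->; rewrite !subrr !normr0 mulr0 ltxx.
  have yz0 : 0 < `|y - z| by apply: le_lt_trans bad; rewrite mulr_ge0// invr_ge0 ltW.
  rewrite /= -scalemxAl normrZ normfV normr_id mulrC ler_pdivrMr//.
  by move: bad; rewrite mulmxBl mulrC ltr_pdivrMr// mulrC => /ltW.
have : v *m p = 0.
  apply/eqP; rewrite -normr_le0; apply/ler_addgt0Pr => e e0; rewrite add0r.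
  pose d : R := e / (1 + C); have d0 : 0 < d by rewrite divr_gt0// addr_gt0.
  have [w /= wd wv] := Dv d d0.
  rewrite -[v](subrK w) mulmxDl (le_trans (ler_normD _ _))//.
  have -> : e = C * d + d by rewrite -[X in _ + X]mul1r -mulrDl /d mulrC
    addrC divfK// gt_eqF// addr_gt0.
  rewrite lerD// (le_trans (pC _))// ler_wpM2l//; first exact: ltW.
  by rewrite distrC ltW.
by move=> /(H _ Sv) v0; move: v1; rewrite v0 normr0 => /eqP; rewrite eq_sym oner_eq0.
Qed.

(** * Generic points by a Baire category argument *)

Lemma closed_norm_ball (R : realType) (m : nat) (a : 'rV[R]_m) (r : R) :
  closed [set y | `|y - a| <= r].
Proof.
apply: (@preimage_closed _ _ (fun y : 'rV_m => `|y - a|) [set t | t <= r]);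
  last exact: closed_le.
move=> v _; apply: (@lipschitz_continuous _ _ _ 1) => y z.
by rewrite mul1r (le_trans (ler_dist_dist _ _))// opprB addrA subrK.
Qed.

(** Nested balls centered in [X]: the [n]-th step shrinks the ball until [F n] holds either at all
    points of [X] in it or at none. The common point of the balls then has the stated property. *)
Lemma baire_in_compact (R : realType) (m : nat) (X : set 'rV[R]_m)
    (x0 : 'rV[R]_m) (r0 : R) (F : nat -> set 'rV[R]_m) :
  X x0 -> 0 < r0 -> compact (X `&` [set y | `|y - x0| <= r0]) ->
  (forall n x, X x ->
     (forall e : R, 0 < e -> exists2 y, F n y & `|y - x| < e) -> F n x) ->
  exists x, [/\ X x, `|x - x0| < r0 & forall n, F n x ->
    exists2 r : R, 0 < r & forall y, X y -> `|y - x| < r -> F n y].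
Proof.
move=> Xx0 r00 cK clF; pose V : Type := 'rV[R]_m.
pose decides n (s : V * R) :=
  (forall y, X y -> `|y - s.1| <= s.2 -> F n y) \/
  (forall y, X y -> `|y - s.1| <= s.2 -> ~ F n y).
pose valid (s : V * R) := X s.1 /\ 0 < s.2.
have /choice[f Hf] : forall ns : nat * (V * R), exists s' : V * R,
    valid ns.2 -> [/\ valid s', `|s'.1 - ns.2.1| + s'.2 < ns.2.2 &
      decides ns.1 s'].
  move=> [n [x r]]; rewrite /valid /=.
  have [[Xx r1]|nv] := pselect (X x /\ 0 < r); last by exists (x, r).
  have [all|/existsNP[y /not_implyP[Xy /not_implyP[yx nF]]]] :=
      pselect (forall y, X y -> `|y - x| < r -> F n y).
    exists (x, r / 2) => _; split => /=; first by split => //; exact: divr_gt0.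
      by rewrite subrr normr0 add0r; lra.
    by left => y Xy /= yx; apply: all => //; apply: le_lt_trans yx _; lra.
  (* As [F n] is relatively closed, a point [y] of [X] outside it keeps a positive distance from
     it. *)
  have [e e0 He] : exists2 e : R, 0 < e & forall z, F n z -> e <= `|z - y|.
    apply: contrapT => /forall2NP ne; apply/nF/clF => // e e0.
    have [//|/existsNP[z /not_implyP[Fz /negP]]] := ne e.
    by rewrite -ltNge => ?; exists z.
  pose r' : R := Num.min (e / 2) ((r - `|y - x|) / 2).
  have r'0 : 0 < r' by rewrite lt_min !divr_gt0//= subr_gt0.
  have r'1 : r' <= e / 2 by rewrite ge_min lexx.
  have r'2 : r' <= (r - `|y - x|) / 2 by rewrite ge_min lexx orbT.
  exists (y, r') => _; split => //=; first by clearbody r'; lra.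
  by right => z Xz /= zy /He; clearbody r'; move: zy; lra.
pose fix s n : V * R := if n is k.+1 then f (k, s k) else (x0, r0).
have vs n : valid (s n) by elim: n => [//|n IH] /=; have [] := Hf (n, s n) IH.
have step n : `|(s n.+1).1 - (s n).1| + (s n.+1).2 < (s n).2.
  by have [_ + _] := Hf (n, s n) (vs n).
have dec n : decides n (s n.+1) by have [_ _] := Hf (n, s n) (vs n).
have nest n j y : `|y - (s (n + j)%N).1| <= (s (n + j)%N).2 ->
    `|y - (s n).1| <= (s n).2.
  elim: j y => [|j IH] y; first by rewrite addn0.
  rewrite addnS => yb; apply: IH; have := step (n + j)%N.
  have := ler_distD (s (n + j).+1).1 y (s (n + j)%N).1.
  by move: yb; clear; lra.
have sn n j : `|(s (n + j)%N).1 - (s n).1| <= (s n).2.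
  by apply: (nest n j); rewrite subrr normr0; case: (vs (n + j)%N) => _ /ltW.
have Ks : \forall n \near \oo, (X `&` [set y | `|y - x0| <= r0]) (s n).1.
  by exists 0%N => // n _; split; [case: (vs n)|exact: (sn 0%N n)].
have [x [[Xx xb] clx]] := cK ((fun n => (s n).1) @ \oo) _ Ks.
have xn n : `|x - (s n).1| <= (s n).2.
  apply: (@closed_norm_ball _ _ (s n).1 (s n).2) => B nB.
  have Fn : \forall j \near \oo, `|(s j).1 - (s n).1| <= (s n).2.
    by exists n => // j /= nj; rewrite -(subnKC nj); exact: sn.
  have [z [zn Bz]] := clx [set y | `|y - (s n).1| <= (s n).2] B Fn nB.
  by exists z.
(* The strict inequality in [step] puts the limit in the interior of every ball, leaving a positive
   radius around it. *)
have xlt n : `|x - (s n).1| < (s n).2.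
  have := ler_distD (s n.+1).1 x (s n).1; have := xn n.+1; have := step n.
  by clear; lra.
exists x; split => //; first exact: (xlt 0%N).
move=> n Fx; exists ((s n.+1).2 - `|x - (s n.+1).1|); first by rewrite subr_gt0.
move=> y Xy yx; case: (dec n) => H; last by have := H x Xx (xn n.+1) Fx.
apply: H => //; have := ler_distD x y (s n.+1).1; move: yx; clear; lra.
Qed.

(* The point is chosen in the interior (relative to X) of every closed set
   { x | no difference y - x with y in X close to x points close to q } to
   which it belongs, the directions q being rational. *)
Lemma generic_point (R : realType) (m : nat) (X : set 'rV[R]_m)
    (x0 : 'rV[R]_m) (r0 : R) :
  X x0 -> 0 < r0 -> compact (X `&` [set y | `|y - x0| <= r0]) ->
  exists x, [/\ X x, `|x - x0| < r0 & forall v, pcone X x v -> tcone X x v].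
Proof.
move=> Xx0 r00 cK.
pose E (i : 'rV[rat]_m * nat * nat) : set 'rV[R]_m :=
  [set x | forall y, X y -> `|y - x| < i.2.+1%:R^-1 -> forall t : R, 0 <= t ->
     i.1.2.+1%:R^-1 <= `|t *: (y - x) - map_mx ratr i.1.1|].
pose F n := if unpickle n is Some i then E i else setT.
have [|x [Xx xx0 Hx]] := @baire_in_compact R m X x0 r0 F Xx0 r00 cK.
  move=> n x Xx; rewrite /F; case: unpickle => // -[[q d] N] H y Xy /= yx t t0.
  apply/ler_addgt0Pr => e e0.
  have N0 : 0 < N.+1%:R^-1 - `|y - x| by rewrite subr_gt0.
  have t1 : 0 < t + 1 by rewrite ltr_wpDl.
  have m0 : 0 < Num.min (N.+1%:R^-1 - `|y - x|) (e / (t + 1)).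
    by rewrite lt_min N0 divr_gt0.
  have [z Ez] := H _ m0; rewrite lt_min => /andP[z1 z2].
  have yz : `|y - z| < N.+1%:R^-1.
    by have := ler_distD x y z; rewrite (distrC x z); move: z1; clear; set a : R := N.+1%:R^-1; lra.
  apply: (le_trans (Ez y Xy yz t t0)) => /=.
  have -> : t *: (y - z) - map_mx ratr q =
    (t *: (y - x) - map_mx ratr q) - t *: (z - x).
    by apply/rowP => j; rewrite !mxE; ring.
  rewrite (le_trans (ler_normB _ _))// lerD2l normrZ ger0_norm//.
  move: z2; rewrite ltr_pdivlMr// mulrDr mulr1 => z2.
  by rewrite mulrC (le_trans _ (ltW z2))// lerDl.
exists x; split => // v Pv; apply: contrapT => nT.
have [e e0 He] : exists2 e : R, 0 < e & forall y, X y -> `|y - x| < e ->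
    forall t : R, 0 <= t -> e <= `|t *: (y - x) - v|.
  apply: contrapT => /forall2NP ne; apply: nT => e e0.
  apply: contrapT => bad; case: (ne e) => [/(_ e0)//|]; apply=> y Xy yx t t0.
  rewrite leNgt; apply/negP => tv; apply: bad; exists y, x, t.
  by split.
have e20 : 0 < e / 2 by rewrite divr_gt0.
have [N Ne] : exists N : nat, N.+1%:R^-1 < e / 2.
  exists (Num.truncn (e / 2)^-1); rewrite invf_plt ?posrE//; exact: truncnS_gt.
have N0 : 0 < N.+1%:R^-1 :> R by rewrite invr_gt0.
have /choice[q Hq] : forall i, exists q : rat,
    `|v ord0 i - ratr q| < N.+1%:R^-1.
  move=> i.
  have /rat_in_itvoo[q] : v ord0 i < v ord0 i + N.+1%:R^-1 by rewrite ltrDl.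
  rewrite in_itv/= => /andP[q1 q2]; exists q.
  by rewrite distrC gtr0_norm ?subr_gt0// ltrBlDl.
pose Q : 'rV[rat]_m := \row_i q i.
have vQ : `|v - map_mx ratr Q| < N.+1%:R^-1.
  by apply: rV_norm_ltP => // i; rewrite !mxE; exact: Hq.
(* Nonnegative multiples of a short [y - x] stay at distance [e] from [v], and [Q] is within
   [1/(N+1) < e/2] of [v], so they stay at distance [1/(N+1)] from [Q]. *)
have Ex : E (Q, N, N) x.
  move=> y Xy /= yx t t0.
  have := He y Xy (lt_trans yx _) t t0.
  have N1e : N.+1%:R^-1 < e by apply: lt_trans Ne _; move: e0; clear; lra.
  move=> /(_ N1e) h.
  have := ler_normB (t *: (y - x) - map_mx ratr Q) (v - map_mx ratr Q).
  rewrite opprB addrA subrK => h2.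
  by move: h h2 Ne vQ; clear; set a : R := N.+1%:R^-1; lra.
have [|r r1 Hr] := Hx (pickle (Q, N, N)); first by rewrite /F pickleK.
(* A pair at scale [d] has its second point where [E (Q, N, N)] holds, yet a multiple of its
   difference comes closer than [1/(N+1)] to [Q]. *)
pose d : R := Num.min (N.+1%:R^-1 - `|v - map_mx ratr Q|)
  (Num.min r (N.+1%:R^-1 / 2)).
have d0 : 0 < d by rewrite !lt_min subr_gt0 vQ r1 divr_gt0.
have [y [z [t [[/= Xy Xz]]]]] := Pv d d0.
rewrite !lt_min => /and3P[_ yr yN] /and3P[_ zr zN] t0 /andP[tv _].
have := Hr z Xz zr; rewrite /F pickleK => /(_ y Xy) /=.
have yz : `|y - z| < N.+1%:R^-1.
  have := ler_distD x y z; rewrite (distrC x z).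
  by move: yN zN; clear; set a : R := N.+1%:R^-1; lra.
move=> /(_ yz t t0); apply/negP; rewrite -ltNge.
have := ler_normD (t *: (y - z) - v) (v - map_mx ratr Q).
by rewrite addrA subrK; move: tv; clear; set a : R := N.+1%:R^-1; lra.
Qed.

(** * Linear projections near a point: expansion and touching balls *)

Lemma compact_sub_ball (R : realType) (m : nat) (X : set 'rV[R]_m)
    (x0 x : 'rV[R]_m) (r0 r : R) :
  compact (X `&` [set y | `|y - x0| <= r0]) -> `|x - x0| + r <= r0 ->
  compact (X `&` [set y | `|y - x| <= r]).
Proof.
move=> cK rr.
have sub y : `|y - x| <= r -> `|y - x0| <= r0.
  by have := ler_distD x y x0; move: rr; clear; lra.
apply: (subclosed_compact _ cK) => [|y [Xy /= yr]]; last by split => //=; exact: sub.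
rewrite (_ : _ `&` _ = (X `&` [set y | `|y - x0| <= r0]) `&`
    [set y | `|y - x| <= r]).
  apply: closedI; first exact: (compact_closed (@norm_hausdorff _ _)).
  exact: closed_norm_ball.
by apply/seteqP; split=> y [] => [Xy /= yr|[Xy /= _] yr];
  split => //; split => //=; exact: sub.
Qed.

(** The form in which most error estimates below are passed to the limit; the restriction [e <= 1]
    lets products of errors be absorbed into [B * e]. *)
Lemma le0_mul_small (R : realType) (A B : R) :
  (forall e : R, 0 < e -> e <= 1 -> A <= B * e) -> A <= 0.
Proof.
move=> H; apply/ler_addgt0Pr => e e0; rewrite add0r.
have B0 : 0 < `|B| + 1 by rewrite ltr_wpDl.
pose d : R := Num.min 1 (e / (`|B| + 1)).
have d0 : 0 < d by rewrite lt_min ltr01 divr_gt0.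
have d1 : d <= 1 by rewrite ge_min lexx.
apply: (le_trans (H d d0 d1)); apply: (@le_trans _ _ ((`|B| + 1) * d)).
  by rewrite ler_wpM2r// ?(ltW d0)// (le_trans (ler_norm _))// lerDl.
by rewrite mulrC -ler_pdivlMr// ge_min lexx orbT.
Qed.

(** The bound on secants through [y] passes to their limits. It makes [p] injective on the cones at
    all points near [x], even those that are not generic. *)
Lemma tcone_expansion (R : realType) (m k : nat) (X : set 'rV[R]_m)
    (y v : 'rV[R]_m) (p : 'M[R]_(m, k)) (r c : R) :
  0 < r -> 0 <= c ->
  (forall z, X z -> `|z - y| < r -> `|z - y| <= c * `|z *m p - y *m p|) ->
  tcone X y v -> `|v| <= c * `|v *m p|.
Proof.
move=> r0 c0 H Tv; have [C C0 pC] := mulmx_norm_bound p.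
rewrite -subr_le0; apply: (@le0_mul_small _ _ (1 + c * C)) => e e0 e1.
have m0 : 0 < Num.min e r by rewrite lt_min e0.
have [z [y' [t [[/= Xz -> zy] t0]]]] := Tv _ m0.
move: zy; rewrite !lt_min => /andP[_ zr] /andP[zv _].
have h1 : `|t *: (z - y)| <= c * `|(t *: (z - y)) *m p|.
  rewrite -scalemxAl !normrZ mulrCA ler_wpM2l// mulmxBl; exact: H.
have h2 : `|(t *: (z - y)) *m p| <= `|v *m p| + C * e.
  rewrite -[t *: _](subrK v) mulmxDl addrC (le_trans (ler_normD _ _))//.
  by rewrite lerD2l (le_trans (pC _))// (ler_pM2l C0) ltW.
have h3 : `|v| <= `|t *: (z - y)| + e.
  rewrite -[v](subrK (t *: (z - y))) addrC (le_trans (ler_normD _ _))//.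
  by rewrite lerD2l distrC ltW.
have h4 : c * `|(t *: (z - y)) *m p| <= c * (`|v *m p| + C * e) by rewrite ler_wpM2l.
by move: h1 h3 h4; clear; rewrite mulrDl mulrDr mulrA; lra.
Qed.

(** Take a missed value [b] close to the image of [x], and let [y] minimize the Euclidean distance
    from [b] to the projected points. With [nu] pointing from the image of [y] to [b], a tangent
    vector projecting to a positive multiple of [nu] would decrease this distance. *)
Lemma touching_point (R : realType) (m k : nat) (X : set 'rV[R]_m)
    (x : 'rV[R]_m) (p : 'M[R]_(m, k)) (r c : R) :
  X x -> 0 < r -> 0 < c -> compact (X `&` [set y | `|y - x| <= r]) ->
  (forall y z, X y -> X z -> `|y - x| <= r -> `|z - x| <= r ->
     `|y - z| <= c * `|y *m p - z *m p|) ->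
  ~ (exists2 d : R, 0 < d & forall b, `|b - x *m p| < d ->
       exists y, [/\ X y, `|y - x| < r & y *m p = b]) ->
  exists y nu, [/\ X y, `|y - x| < r, nu != 0 &
    forall v a, tcone X y v -> v *m p = a *: nu -> a <= 0].
Proof.
move=> Xx r0 c0 cK biL nsurj.
have [C C0 pC] := mulmx_norm_bound p.
(* A crude comparison of sup norm and Euclidean norm puts the image of the minimizer within
   [(k + 1) * d] of [b], hence within [K * d] of the image of [x]; the choice of [d] then gives
   [|y - x| <= r / 2]. *)
pose K : R := k%:R + 2.
have K0 : 0 < K by rewrite ltr_wpDl.
pose d : R := r / (2 * (c * K)).
have d0 : 0 < d by rewrite divr_gt0// !mulr_gt0.
have [b [bd bmiss]] : exists b, `|b - x *m p| < d /\
    forall y, X y -> `|y - x| < r -> y *m p <> b.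
  apply: contrapT => nb; apply: nsurj; exists d => // b bd.
  apply: contrapT => ny; apply: nb; exists b; split => // y Xy yx yb.
  by apply: ny; exists y.
(* Balls of the sup norm have corners; a touching ball must have a tangent hyperplane, hence the
   Euclidean product. *)
pose dot (u w : 'rV[R]_k) := \sum_i u ord0 i * w ord0 i.
have dot_le u w : dot u w <= k%:R * (`|u| * `|w|).
  rewrite (le_trans (ler_norm _))// (le_trans (ler_norm_sum _ _ _))//.
  rewrite mulr_natl -[X in _ *+ X]card_ord -sumr_const ler_sum// => i _.
  by rewrite normrM ler_pM// rV_coord_le_norm.
have le_dot u : `|u| ^+ 2 <= dot u u.
  have dot0 : 0 <= dot u u by apply: sumr_ge0 => i _; rewrite -expr2 sqr_ge0.
  rewrite -(@sqr_sqrtr _ (dot u u))// ler_sqr ?nnegrE ?sqrtr_ge0//.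
  apply: rV_norm_leP => [|j]; first exact: sqrtr_ge0.
  rewrite -sqrtr_sqr ler_wsqrtr// /dot (bigD1 j)//= -expr2 lerDl sumr_ge0//.
  by move=> i _; rewrite -expr2 sqr_ge0.
pose g y := dot (y *m p - b) (y *m p - b).
have cg : continuous g.
  apply: continuous_big => [|i _]; first exact: add_continuous.
  have ci : continuous (fun y : 'rV[R]_m => (y *m p - b) ord0 i).
    apply: (@lipschitz_continuous _ _ _ C) => u w.
    rewrite -[_ - _](_ : ((u - w) *m p) ord0 i = _); last first.
      by rewrite mulmxBl !mxE; ring.
    by rewrite (le_trans (rV_coord_le_norm _ _)).
  move=> y; exact: (cvgM (ci y) (ci y)).
have [y] : exists2 y, y \in (X `&` [set y | `|y - x| <= r]) &
    forall z, z \in (X `&` [set y | `|y - x| <= r]) -> g y <= g z.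
  apply: (compact_EVT_min _ cK).
    by exists x; split => //=; rewrite subrr normr0 ltW.
  exact: continuous_subspaceT.
rewrite inE => -[Xy yxr] ymin.
have gx : g y <= g x.
  by apply: ymin; rewrite inE; split => //=; rewrite subrr normr0 ltW.
have yb : `|y *m p - b| <= (k%:R + 1) * d.
  have k0 : 0 <= k%:R :> R by [].
  have kd : 0 <= (k%:R + 1) * d.
    by apply: mulr_ge0; [exact: addr_ge0|exact: ltW].
  rewrite -ler_sqr ?nnegrE//.
  apply: (le_trans (le_dot _)); apply: (le_trans gx).
  apply: (le_trans (dot_le _ _)); rewrite distrC -expr2 exprMn.
  have dd : `|b - x *m p| ^+ 2 <= d ^+ 2.
    by rewrite ler_sqr ?nnegrE //; exact: ltW.
  apply: ler_pM => //.
  by rewrite expr2; move: k0; clear; set K : R := k%:R; nra.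
have yx : `|y - x| < r.
  have h : `|y *m p - x *m p| < K * d.
    have := ler_distD b (y *m p) (x *m p); rewrite /K.
    move: yb bd; clear; rewrite !mulrDl; lra.
  have xx : `|x - x| <= r by rewrite subrr normr0 ltW.
  apply: (le_lt_trans (biL y x Xy Xx yxr xx)).
  have -> : r = 2 * (c * (K * d)).
    by rewrite /d; field; rewrite !gt_eqF.
  have : c * `|y *m p - x *m p| < c * (K * d) by rewrite ltr_pM2l.
  have : 0 < c * (K * d) by apply: mulr_gt0 => //; apply: mulr_gt0.
  clear; lra.
pose nu := b - y *m p.
have nu0 : nu != 0 by rewrite subr_eq0; apply/eqP => /esym; exact: bmiss.
have nuE : nu = b - y *m p by [].
clearbody nu; exists y, nu; split => // v a Tv va.
have N2 : 0 < dot nu nu.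
  by apply: lt_le_trans (le_dot _); rewrite exprn_gt0// normr_gt0.
rewrite -(pmulr_lle0 _ N2).
pose M := k%:R * (C * (`|v| + 1) * C) + k%:R * (C * `|nu|).
apply: (@le0_mul_small _ _ M) => e e0 e1.
have m0 : 0 < Num.min e (r - `|y - x|) by rewrite lt_min e0 subr_gt0.
have [z [y' [t [[/= Xz -> zy] t0]]]] := Tv _ m0.
move: zy; rewrite !lt_min => /andP[zye zyr] /andP[zv _].
have zx : `|z - x| <= r.
  by have := ler_distD y z x; move: zyr; clear; lra.
pose w := z *m p - y *m p.
have wD : w = z *m p - y *m p by [].
have wE : w = (z - y) *m p by rewrite mulmxBl.
clearbody w.
have dotDl u1 u2 u3 : dot (u1 + u2) u3 = dot u1 u3 + dot u2 u3.
  by rewrite /dot -big_split; apply: eq_bigr => i _; rewrite mxE mulrDl.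
have dotZl s u1 u2 : dot (s *: u1) u2 = s * dot u1 u2.
  by rewrite /dot mulr_sumr; apply: eq_bigr => i _; rewrite mxE mulrA.
have dotC u1 u2 : dot u1 u2 = dot u2 u1.
  by apply: eq_bigr => i _; rewrite mulrC.
have dotN u1 u2 : dot (- u1) u2 = - dot u1 u2 by rewrite -scaleN1r dotZl mulN1r.
(* Minimality reads [|w - nu|^2 >= |nu|^2] in the Euclidean norm, which bounds the product of [w]
   and [nu] by a term quadratic in [w]. *)
have min_ineq : dot w nu <= dot w w.
  have zin : z \in X `&` [set y | `|y - x| <= r] by rewrite inE.
  have := ymin z zin; rewrite /g.
  have -> : z *m p - b = w - nu by rewrite wD nuE opprB addrA subrK.
  have -> : y *m p - b = - nu by rewrite nuE opprB.
  have ww : 0 <= dot w w by apply: le_trans (le_dot _); rewrite sqr_ge0.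
  have -> : dot (- nu) (- nu) = dot nu nu by rewrite dotN dotC dotN opprK.
  have dotBB (u1 u2 : 'rV[R]_k) : dot (u1 - u2) (u1 - u2) =
      dot u1 u1 - dot u1 u2 - dot u1 u2 + dot u2 u2.
    rewrite /dot -!sumrB -big_split; apply: eq_bigr => i _.
    by rewrite !mxE /=; ring.
  rewrite (dotBB w nu).
  by move: (dot w w) (dot w nu) (dot nu nu) ww; clear => A B D; lra.
have tw : `|t *: w| <= C * (`|v| + 1).
  rewrite wE scalemxAl (le_trans (pC _))// (ler_pM2l C0).
  rewrite -[t *: _](subrK v) addrC (le_trans (ler_normD _ _))// lerD2l.
  by rewrite (le_trans (ltW zv)).
have w_e : `|w| <= C * e.
  by rewrite wE (le_trans (pC _))// (ler_pM2l C0) ltW.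
have vw : `|v *m p - t *: w| <= C * e.
  rewrite wE scalemxAl -mulmxBl (le_trans (pC _))// (ler_pM2l C0).
  by rewrite distrC ltW.
(* The vector [t *: w] approximates [v *m p]; by minimality its product with [nu] is at most its
   product with [w], which is of order [e] because [t *: w] is bounded and [w] is small. *)
have -> : a * dot nu nu = t * dot w nu + dot (v *m p - t *: w) nu.
  by rewrite va dotDl dotN !dotZl; ring.
have h1 : t * dot w nu <= k%:R * (C * (`|v| + 1) * C) * e.
  apply: (@le_trans _ _ (dot (t *: w) w)); first by rewrite dotZl ler_wpM2l.
  apply: (le_trans (dot_le _ _)); rewrite -!mulrA ler_wpM2l// !mulrA.
  by rewrite -[leRHS]mulrA ler_pM.
have h2 : dot (v *m p - t *: w) nu <= k%:R * (C * `|nu|) * e.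
  apply: (le_trans (dot_le _ _)); rewrite -!mulrA ler_wpM2l// mulrA mulrAC.
  by rewrite ler_wpM2r.
by rewrite /M mulrDl lerD.
Qed.

(** * Lipschitz graphs *)

(** A condition on the kernel alone: differences of vectors of the cone need not lie in the cone. *)
Definition injective_on_cone (R : realType) (m k : nat) (C : set 'rV[R]_m)
    (p : 'M[R]_(m, k)) : Prop :=
  forall v, C v -> v *m p = 0 -> v = 0.

(** What homogeneity leaves in a chart when only derivatives at single points are kept; [T] depends
    on [y] without any continuity. *)
Definition cone_homogeneous (R : realType) (m : nat) (X : set 'rV[R]_m)
    (x : 'rV[R]_m) : Prop :=
  forall y, X y -> exists2 T : 'M[R]_m, T \in unitmx &
    forall v, tcone X y v <-> tcone X x (v *m T).

(** In other words, [X] near [x] is the graph of a [c]-Lipschitz section of [p] over the ball of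
    radius [d]. *)
Definition graph_near (R : realType) (m k : nat) (X : set 'rV[R]_m)
    (x : 'rV[R]_m) (p : 'M[R]_(m, k)) (r c d : R) : Prop :=
  [/\ 0 < r, 0 < c, 0 < d,
    forall y z, X y -> X z -> `|y - x| < r -> `|z - x| < r ->
      `|y - z| <= c * `|y *m p - z *m p|
  & forall b, `|b - x *m p| < d ->
      exists y, [/\ X y, `|y - x| < r & y *m p = b]].

(* If the projection of X missed points close to the image of x, then by
   touching_point and the symmetry of the cones some cone would project into a
   complement of a line, and p would not have the least number of columns. *)
Lemma generic_graph (R : realType) (m k : nat) (X : set 'rV[R]_m)
    (x : 'rV[R]_m) (r0 : R) (p : 'M[R]_(m, k)) :
  X x -> 0 < r0 -> compact (X `&` [set y | `|y - x| <= r0]) ->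
  (forall v, pcone X x v -> tcone X x v) -> cone_homogeneous X x ->
  (forall k' (q : 'M[R]_(m, k')), injective_on_cone (tcone X x) q -> (k <= k')%N) ->
  injective_on_cone (tcone X x) p ->
  exists r c d, graph_near X x p r c d.
Proof.
move=> Xx r00 cK gen hom min tp.
have [|r1 [c [r10 c0 Hc]]] :=
  @dircone_transversal _ _ _ (paratangent_pairs X x) p
    (@paratangent_pairs_mono _ _ X x).
  by move=> v /gen; exact: tp.
pose r : R := Num.min r0 (r1 / 2).
have r_gt0 : 0 < r by rewrite lt_min r00 divr_gt0.
have rr0 : r <= r0 by rewrite ge_min lexx.
have rr1 : r < r1.
  have : r <= r1 / 2 by rewrite ge_min lexx orbT.
  by move: r10; clear; lra.
have biL y z : X y -> X z -> `|y - x| <= r -> `|z - x| <= r ->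
    `|y - z| <= c * `|y *m p - z *m p|.
  by move=> Xy Xz yr zr; apply: Hc; split => //=; exact: le_lt_trans rr1.
have cKr : compact (X `&` [set y | `|y - x| <= r]).
  by apply: (compact_sub_ball cK); rewrite subrr normr0 add0r.
have [[d d0 Hd]|nsurj] := pselect (exists2 d : R, 0 < d &
    forall b, `|b - x *m p| < d ->
      exists y, [/\ X y, `|y - x| < r & y *m p = b]).
  by exists r, c, d; split => // y z Xy Xz yr zr; apply: biL => //; exact: ltW.
have [y [nu [Xy yr nu0 Hnu]]] := touching_point Xx r_gt0 c0 cKr biL nsurj.
have [T Tu HT] := hom y Xy.
(* At [x] the contingent cone equals the paratangent cone, which is symmetric, and the linear
   isomorphism brings the symmetry to [y]. *)
have symm v : tcone X y v -> tcone X y (- v).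
  by move=> /HT Tv; apply/HT; rewrite mulNmx; apply/gen/pconeN/tcone_pcone.
have exp v : tcone X y v -> v *m p = 0 -> v = 0.
  move=> Tv vp; have : `|v| <= c * `|v *m p|.
    apply: (@tcone_expansion _ _ _ X y v p (r - `|y - x|)) Tv.
    - by rewrite subr_gt0.
    - exact: ltW.
    - move=> z Xz zy; apply: biL => //; last exact: ltW.
      by have := ler_distD y z x; move: zy; clear; lra.
  by rewrite vp normr0 mulr0 normr_le0 => /eqP.
(* In a full-rank factorization of [cokermx nu], the factor [A] has [k - 1] columns and kills
   exactly the line of [nu]. *)
have [A [B AB]] : exists (A : 'M[R]_(k, \rank (cokermx nu)))
    (B : 'M[R]_(\rank (cokermx nu), k)), A *m B = cokermx nu.
  by exists (col_base (cokermx nu)), (row_base (cokermx nu)); exact: mulmx_base.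
pose q : 'M[R]_(m, \rank (cokermx nu)) := invmx T *m p *m A.
have : injective_on_cone (tcone X x) q.
  move=> w Tw; rewrite /q !mulmxA => wq.
  pose v := w *m invmx T.
  have wE : w = v *m T by rewrite /v mulmxKV.
  have Tv : tcone X y v by apply/HT; rewrite -wE.
  have : (v *m p <= nu)%MS.
    by rewrite submxE -AB mulmxA wq mul0mx.
  move=> /sub_rVP[a va].
  have a0 : a <= 0 by apply: Hnu Tv va.
  have Na0 : - a <= 0.
    by apply: Hnu (symm _ Tv) _; rewrite mulNmx va scaleNr.
  have {a0 Na0} a0 : a = 0 by move: a0 Na0; clear; lra.
  by rewrite wE (exp v Tv) ?mul0mx// va a0 scale0r.
move=> /min; rewrite mxrank_coker rank_rV nu0 => kk.
have k0 : (0 < k)%N.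
  rewrite lt0n; apply: contraNN nu0 => /eqP k0; apply/eqP/rowP => i.
  by have := ltn_ord i; rewrite {2}k0.
by move: kk; rewrite leqNgt subn1 ltn_predL k0.
Qed.

(** Precomposition with [sg], a coordinatewise clamp followed by an affine map into the ball, makes
    the function globally Lipschitz. The clamp is the identity on [[-1, 2]], hence invisible at a
    point of the unit cube for increments below 1. *)
Lemma lipschitz_on_ball_partials (R : realType) (k m : nat)
    (s : 'rV[R]_k -> 'rV[R]_m) (beta : 'rV[R]_k) (d c : R) : 0 < d -> 0 <= c ->
  (forall a b, `|a - beta| < d -> `|b - beta| < d ->
     `|s a - s b| <= c * `|a - b|) ->
  exists b (U : 'M[R]_(k, m)), `|b - beta| < d /\
    forall i (e : R), 0 < e -> exists2 del : R, 0 < del &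
      forall h : R, `|h| < del ->
        `|s (b + h *: delta_mx ord0 i) - s b - h *: row i U| <= e * `|h|.
Proof.
(* Clamped coordinates are within [3 / 2] of the center [1 / 2], so [sg] stays within [3 / 4 * d] of
   [beta]. *)
move=> d0 c0 sc; pose eta : R := d / 2.
have eta0 : 0 < eta by rewrite divr_gt0.
pose cl (t : R) : R := Num.max (-1) (Num.min t 2).
have cl_lip (t t' : R) : `|cl t - cl t'| <= `|t - t'|.
  have max_lip (u u' : R) : `|Num.max (-1) u - Num.max (-1) u'| <= `|u - u'|.
    have := ler_norm (u - u'); have := ler_norm (u' - u); rewrite (distrC u' u).
    move=> h1 h2; rewrite ler_norml; case: (leP (-1) u); case: (leP (-1) u');
      move: h1 h2; clear => *; apply/andP; split; lra.
  have min_lip (u u' : R) : `|Num.min u 2 - Num.min u' 2| <= `|u - u'|.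
    have := ler_norm (u - u'); have := ler_norm (u' - u); rewrite (distrC u' u).
    move=> h1 h2; rewrite ler_norml; case: (leP u 2); case: (leP u' 2);
      move: h1 h2; clear => *; apply/andP; split; lra.
  exact: le_trans (max_lip _ _) (min_lip _ _).
have cl_bnd (t : R) : `|cl t - 1 / 2| <= 3 / 2.
  rewrite /cl ler_norml; case: (leP t 2) => h1.
    by case: (leP (-1) t) => h2; move: h1 h2; clear => *; apply/andP; split; lra.
  by case: (leP (-1) 2) => h2; move: h1 h2; clear => *; apply/andP; split; lra.
have cl_id (t : R) : -1 <= t -> t <= 2 -> cl t = t.
  by move=> t1 t2; rewrite /cl min_l// max_r.
pose sg (a : 'rV[R]_k) : 'rV[R]_k := beta + eta *: \row_j (cl (a ord0 j) - 1 / 2).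
have sg_ball a : `|sg a - beta| < d.
  rewrite /sg addrAC subrr add0r normrZ (gtr0_norm eta0).
  apply: (@le_lt_trans _ _ (eta * (3 / 2))).
    rewrite (ler_pM2l eta0); apply: rV_norm_leP => // j; rewrite mxE; exact: cl_bnd.
  by rewrite /eta; move: d0; clear; lra.
have sg_lip a a' : `|sg a - sg a'| <= eta * `|a - a'|.
  rewrite /sg opprD addrACA subrr add0r -scalerBr normrZ (gtr0_norm eta0).
  rewrite (ler_pM2l eta0); apply: rV_norm_leP => // j; rewrite !mxE.
  have -> : cl (a ord0 j) - 1 / 2 - (cl (a' ord0 j) - 1 / 2) =
    cl (a ord0 j) - cl (a' ord0 j) by ring.
  by apply: (le_trans (cl_lip _ _)); have := rV_coord_le_norm (a - a') j; rewrite !mxE.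
have F_lip a a' : `|(s \o sg) a - (s \o sg) a'| <= (c * eta) * `|a - a'|.
  apply: (le_trans (sc _ _ (sg_ball a) (sg_ball a'))).
  by rewrite -mulrA ler_wpM2l.
have [a a01 Ha] := lipschitz_has_partials F_lip.
have /choice[L0 HL0] := fun ij : 'I_k * 'I_m => Ha ij.1 ij.2.
exists (sg a), (\matrix_(i, j) (L0 (i, j) / eta)); split; first exact: sg_ball.
move=> i e e0.
have ee0 : 0 < e * eta by rewrite mulr_gt0.
pose P j : set R := [set h | `|(s \o sg) (a + h *: delta_mx ord0 i) ord0 j -
  (s \o sg) a ord0 j - h * L0 (i, j)| <= (e * eta) * `|h|].
have : nbhs (0 : R) [set h | forall j, P j h].
  apply: (@filter_forall _ _ P (nbhs (0 : R))) => j; have [del del0 H] := HL0 (i, j) _ ee0.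
  by apply/nbhs_normP; exists del => //= h; rewrite /ball_ /= sub0r normrN => /H.
move=> /nbhs_normP[del /= del0 H]; exists (Num.min del 1 * eta).
  by rewrite mulr_gt0// lt_min del0 ltr01.
move=> h hd; pose h' : R := h / eta.
have hE : h = eta * h' by rewrite /h' mulrC divfK// gt_eqF.
have : `|h'| < Num.min del 1.
  by rewrite /h' normrM normfV (gtr0_norm eta0) ltr_pdivrMr.
rewrite lt_min => /andP[h'd h'1]; clearbody h'.
have h'j := H h'; rewrite /ball_ /= sub0r normrN in h'j; move/(_ h'd) in h'j.
have sgE : sg (a + h' *: delta_mx ord0 i) = sg a + h *: delta_mx ord0 i.
  rewrite hE -scalerA /sg -addrA -scalerDr; congr (_ + _ *: _).
  apply/rowP => j; rewrite !mxE.
  have := a01 j; rewrite in_itv/= => /andP[a0 a1].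
  move: h'1; rewrite ltr_norml => /andP[h1 h2].
  rewrite (cl_id (a ord0 j)); [|lra|lra].
  have [ij|ij] /= := eqVneq j i; rewrite ?mulr1 ?mulr0 ?addr0.
    by rewrite cl_id; [ring|lra|lra].
  by rewrite cl_id; [ring|lra|lra].
apply: rV_norm_leP => [|j]; first by rewrite mulr_ge0// ltW.
have := h'j j; rewrite /P /= sgE !mxE hE normrM (gtr0_norm eta0).
have -> : eta * h' * (L0 (i, j) / eta) = h' * L0 (i, j).
  by field; rewrite gt_eqF.
by rewrite !mulrA.
Qed.

Lemma graph_section (R : realType) (m k : nat) (X : set 'rV[R]_m) x
    (p : 'M[R]_(m, k)) (r c d : R) : graph_near X x p r c d ->
  exists s : 'rV[R]_k -> 'rV[R]_m,
  [/\ forall b, `|b - x *m p| < d -> [/\ X (s b), `|s b - x| < r & s b *m p = b],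
      forall b b', `|b - x *m p| < d -> `|b' - x *m p| < d ->
        `|s b - s b'| <= c * `|b - b'|
    & forall z, X z -> `|z - x| < r -> `|z *m p - x *m p| < d ->
        s (z *m p) = z].
Proof.
move=> [r0 c0 d0 biL surj].
have /choice[s Hs] : forall b, exists y, `|b - x *m p| < d ->
    [/\ X y, `|y - x| < r & y *m p = b].
  move=> b; have [bd|] := pselect (`|b - x *m p| < d); last by exists 0.
  by have [y Hy] := surj b bd; exists y.
exists s; split => // [b b' /Hs[Xb br bE] /Hs[Xb' br' bE']|z Xz zr /Hs[Xs sr sE]].
  by rewrite -{2}bE -{2}bE'; exact: biL.
apply/eqP; rewrite -subr_eq0 -normr_le0.
by apply: le_trans (biL _ _ Xs Xz sr zr) _; rewrite sE subrr normr0 mulr0.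
Qed.

(** A tangent vector above [w] may be a limit of secants whose endpoints [z] do not lie above the
    line through [b]. With [h = a / t], the point above [b + h *: w] replaces [z]; by the Lipschitz
    bound on [s] the error, even multiplied by [t], tends to zero. *)
Lemma tcone_line (R : realType) (m k : nat) (X : set 'rV[R]_m)
    (p : 'M[R]_(m, k)) (s : 'rV[R]_k -> 'rV[R]_m) (b w : 'rV[R]_k)
    (u : 'rV[R]_m) (rho c : R) :
  0 < rho -> 0 <= c -> w != 0 -> s b *m p = b ->
  (forall z, X z -> `|z - s b| < rho -> s (z *m p) = z) ->
  (forall a a', `|a - b| < rho -> `|a' - b| < rho ->
     `|s a - s a'| <= c * `|a - a'|) ->
  (forall e : R, 0 < e -> exists2 del : R, 0 < del & forall h : R, `|h| < del ->
     `|s (b + h *: w) - s b - h *: u| <= e * `|h|) ->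
  forall v a, tcone X (s b) v -> v *m p = a *: w -> v = a *: u.
Proof.
move=> rho0 c0 w0 sbp sloc slip sder v a Tv va.
have [C C0 pC] := mulmx_norm_bound p.
have [v0|v0] := eqVneq v 0.
  move: va; rewrite v0 mul0mx => /esym/eqP; rewrite scaler_eq0 (negbTE w0) orbF.
  by move=> /eqP ->; rewrite scale0r.
have nv0 : 0 < `|v| by rewrite normr_gt0.
apply/eqP; rewrite -subr_eq0 -normr_le0.
apply: (@le0_mul_small _ _ (1 + c * C + `|a|)) => e e0 e1.
have [del del0 Hdel] := sder e e0.
have nw0 : 0 < `|w| by rewrite normr_gt0.
pose kap : R := Num.min del (rho / `|w|).
have kap0 : 0 < kap by rewrite lt_min del0 divr_gt0.
pose e' : R := Num.min (Num.min e rho)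
  (Num.min (rho / C) (Num.min (`|v| / 2) (kap * `|v| / 2 / (`|a| + 1)))).
have a10 : 0 < `|a| + 1 by rewrite ltr_wpDl.
have e'0 : 0 < e' by rewrite !lt_min e0 rho0 !divr_gt0// mulr_gt0.
have [z [y' [t [[/= Xz -> zy] t0 zv]]]] := Tv _ e'0.
have e'e : e' <= e by rewrite !ge_min lexx.
have e'rho : e' <= rho by rewrite !ge_min lexx orbT.
have e'C : e' <= rho / C by rewrite !ge_min lexx !orbT.
have e'v : e' <= `|v| / 2 by rewrite !ge_min lexx !orbT.
have e'k : e' <= kap * `|v| / 2 / (`|a| + 1) by rewrite !ge_min lexx !orbT.
clearbody e'.
(* As [v] is nonzero, a secant shorter than [e'] must be stretched by a large [t], which makes
   [h = a / t] small enough for the derivative of [s] along [w]. *)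
have tz : `|v| / 2 < t * e'.
  have h1 : `|v| - e' < `|t *: (z - s b)|.
    have := ler_distD (t *: (z - s b)) 0 v.
    by rewrite !sub0r !normrN; move: zv; clear; lra.
  move: h1; rewrite normrZ ger0_norm// => h1.
  have [t0'|] := ltP 0 t.
    have : t * `|z - s b| < t * e' by rewrite ltr_pM2l.
    by move: h1 e'v; clear; lra.
  move=> t0'; have tE : t = 0 by apply/eqP; rewrite eq_le t0' t0.
  by move: h1 e'v nv0; rewrite tE mul0r; clear; lra.
have t_gt0 : 0 < t.
  rewrite lt_neqAle t0 andbT; apply: contraTneq tz => <-.
  by rewrite mul0r -leNgt divr_ge0.
pose h : R := a / t.
have th : t * h = a by rewrite /h mulrC divfK// gt_eqF.
have hk : `|h| < kap.
  rewrite /h normrM normfV (gtr0_norm t_gt0) ltr_pdivrMr//.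
  have h1 : e' * (`|a| + 1) <= kap * (`|v| / 2).
    by move: e'k; rewrite ler_pdivlMr// mulrA.
  have h2 : kap * (`|v| / 2) < kap * (t * e') by rewrite ltr_pM2l.
  have ha : `|a| * e' < (`|a| + 1) * e' by rewrite (ltr_pM2r e'0) ltrDl.
  rewrite -(ltr_pM2r e'0); move: h1 h2 ha; clear; lra.
have [hdel hrho] : `|h| < del /\ `|h *: w| < rho.
  move: hk; rewrite lt_min => /andP[-> h2]; split => //.
  by rewrite normrZ -ltr_pdivlMr.
have zrho : `|z *m p - b| < rho.
  rewrite -{1}sbp -mulmxBl; apply: (le_lt_trans (pC _)).
  by rewrite mulrC -ltr_pdivlMr//; exact: lt_le_trans zy e'C.
have zE : s (z *m p) = z by apply: sloc => //; exact: lt_le_trans zy e'rho.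
have E1 : `|t *: (z - s (b + h *: w))| <= c * (C * e').
  rewrite normrZ (gtr0_norm t_gt0) -{1}zE.
  have bh : `|b + h *: w - b| < rho by rewrite addrAC subrr add0r.
  apply: (@le_trans _ _ (t * (c * `|z *m p - (b + h *: w)|))).
    by rewrite (ler_pM2l t_gt0); exact: slip.
  rewrite mulrCA ler_wpM2l// -{1}(gtr0_norm t_gt0) -normrZ.
  have -> : t *: (z *m p - (b + h *: w)) = (t *: (z - s b) - v) *m p.
    rewrite mulmxBl -scalemxAl mulmxBl sbp va opprD addrA scalerBr.
    by rewrite [t *: (h *: w)]scalerA th.
  by rewrite (le_trans (pC _))// (ler_pM2l C0) ltW.
have E2 : `|t *: (s (b + h *: w) - s b - h *: u)| <= e * `|a|.
  rewrite normrZ (gtr0_norm t_gt0) -th normrM (gtr0_norm t_gt0) mulrCA.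
  by rewrite (ler_pM2l t_gt0); exact: Hdel.
have -> : v - a *: u = (v - t *: (z - s b)) + t *: (z - s (b + h *: w)) +
    t *: (s (b + h *: w) - s b - h *: u).
  by rewrite -th; apply/rowP => j; rewrite !mxE; ring.
have zv' : `|v - t *: (z - s b)| <= e by rewrite distrC ltW// (lt_le_trans zv).
have ce : c * (C * e') <= c * (C * e) by rewrite ler_wpM2l// (ler_pM2l C0).
apply: (le_trans (ler_normD _ _)); apply: (@le_trans _ _ (e + c * (C * e) + e * `|a|)).
  rewrite lerD// (le_trans (ler_normD _ _))// lerD//.
  exact: le_trans E1 ce.
by rewrite !mulrDl mul1r mulrA (mulrC e).
Qed.

(* Moving from x to a nearby point of X by steps whose projections are parallel
   to the axes: as every paratangent vector at x is tangent, the hypothesis on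
   the tangent vectors projecting to an axis holds uniformly near x. *)
Lemma generic_tcone_linear (R : realType) (m k : nat) (X : set 'rV[R]_m)
    (x : 'rV[R]_m) (p : 'M[R]_(m, k)) (u : 'M[R]_(k, m)) (r c d : R) :
  X x -> (forall v, pcone X x v -> tcone X x v) ->
  graph_near X x p r c d -> u *m p = 1%:M ->
  (forall v i a, tcone X x v -> v *m p = a *: delta_mx ord0 i ->
     v = a *: row i u) ->
  forall v, tcone X x v -> v = v *m p *m u.
Proof.
move=> Xx gen gr up Hu v Tv.
have [s [Hs slip sloc]] := graph_section gr.
have [r0 c0 d0 biL surj] := gr.
have [C C0 pC] := mulmx_norm_bound p.
have [D D0 uD] := mulmx_norm_bound u.
(* The defect of [w] from lying in the row space of [u]; being additive, it can be summed along a
   path. *)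
pose res (w : 'rV[R]_m) := w - w *m p *m u.
have step i (e : R) : 0 < e -> exists2 del : R, 0 < del & forall y z a,
    paratangent_pairs X x del (y, z) -> (y - z) *m p = a *: delta_mx ord0 i ->
    `|res (y - z)| <= e * `|y - z|.
  move=> e0; pose f (w : 'rV[R]_m) :=
    w *m p - (w *m p) ord0 i *: (delta_mx ord0 i : 'rV[R]_k).
  have f_lip w w' : `|f w - f w'| <= (C + C) * `|w - w'|.
    have -> : f w - f w' = (w - w') *m p -
        ((w - w') *m p) ord0 i *: delta_mx ord0 i.
      by rewrite /f mulmxBl; apply/rowP => j; rewrite !mxE; ring.
    rewrite mulrDl (le_trans (ler_normB _ _))// lerD//.
    rewrite normrZ norm_delta_mx mulr1.
    by rewrite (le_trans (rV_coord_le_norm _ _)).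
  have res_lip w w' : `|res w - res w'| <= (1 + D * C) * `|w - w'|.
    have -> : res w - res w' = (w - w') - (w - w') *m p *m u.
      by rewrite /res !mulmxBl; apply/rowP => j; rewrite !mxE; ring.
    rewrite mulrDl mul1r (le_trans (ler_normB _ _))// lerD2l -mulrA.
    by rewrite (le_trans (uD _))// (ler_pM2l D0).
  (* A closed set that misses the unit vectors of the paratangent cone, by the hypothesis on the
     axes. *)
  pose Z := [set w | f w = 0] `&` [set w | e <= `|res w|].
  have cZ : closed Z.
    apply: closedI.
      apply: (@preimage_closed _ _ f [set 0]).
        by move=> w _; exact: (lipschitz_continuous f_lip).
      exact: (accessible_closed_set1 (hausdorff_accessible (@norm_hausdorff _ _))).
    apply: (@preimage_closed _ _ (fun w => `|res w|) [set t | e <= t]);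
      last exact: closed_ge.
    move=> w _; apply: (@lipschitz_continuous _ _ _ (1 + D * C)) => w1 w2.
    by rewrite (le_trans (ler_dist_dist _ _)).
  have [|del del0 Hdel] := dircone_avoid (@paratangent_pairs_mono _ _ X x) cZ.
    move=> w /gen Tw w1 [/= fw]; rewrite leNgt => /negP; apply.
    have wE : w *m p = (w *m p) ord0 i *: delta_mx ord0 i.
      by apply/eqP; rewrite -subr_eq0; apply/eqP.
    have wu : w *m p *m u = w.
      transitivity ((w *m p) ord0 i *: row i u); last exact/esym/Hu.
      by rewrite {1}wE -scalemxAl -rowE.
    by rewrite /res wu subrr normr0.
  exists del => // y z a yz yza; have [->|ynz] := eqVneq y z.
    by rewrite /res subrr !mul0mx subrr normr0 mulr0.
  have n0 : 0 < `|y - z| by rewrite normr_gt0 subr_eq0.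
  rewrite leNgt; apply/negP => bad; apply: (Hdel y z yz ynz).
  split => /=.
    rewrite /f -!scalemxAl yza; apply/rowP => j; rewrite !mxE !eqxx /=; ring.
  have -> : res (`|y - z|^-1 *: (y - z)) = `|y - z|^-1 *: res (y - z).
    by rewrite /res -!scalemxAl [RHS]scalerBr.
  by rewrite normrZ normfV normr_id mulrC ler_pdivlMr// ltW.
have near (e : R) : 0 < e -> exists2 del : R, 0 < del & forall z, X z ->
    `|z - x| < del -> `|res (z - x)| <= e * `|z - x|.
  (* Each of the [k] steps of the path costs at most [e1 * c * C * |z - x|]. *)
  move=> e0; pose e1 : R := e / (k%:R * c * C + 1).
  have k0 : 0 <= k%:R :> R by [].
  have kk0 : 0 < k%:R * c * C + 1.
    by rewrite ltr_wpDl// !mulr_ge0// ltW.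
  have e10 : 0 < e1 by rewrite divr_gt0.
  have /choice[del0 Hdel0] : forall i, exists del : R, 0 < del /\ forall y z a,
      paratangent_pairs X x del (y, z) -> (y - z) *m p = a *: delta_mx ord0 i ->
      `|res (y - z)| <= e1 * `|y - z|.
    by move=> i; have [del ? ?] := step i e1 e10; exists del.
  pose mdel : R := \big[Num.min/1]_i del0 i.
  have mdel_gt0 : 0 < mdel.
    rewrite /mdel; elim/big_ind: _ => //= [a b|i _]; first by rewrite lt_min => -> ->.
    by case: (Hdel0 i).
  have mdel_le i : mdel <= del0 i by exact: bigmin_le_cond.
  (* The last two bounds keep the projected path in the domain of [s] and the lifted one within
     [mdel] of [x]. *)
  exists (Num.min r (Num.min (d / C) (mdel / c / C))).
    by rewrite !lt_min r0 !divr_gt0.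
  move=> z Xz; rewrite !lt_min => /and3P[zr zd zm].
  pose w := z *m p - x *m p.
  have wz : `|w| <= C * `|z - x| by rewrite /w -mulmxBl.
  have wd : `|w| < d by apply: le_lt_trans wz _; rewrite mulrC -ltr_pdivlMr.
  have wm : c * `|w| < mdel.
    rewrite mulrC -ltr_pdivlMr//; apply: le_lt_trans wz _.
    by rewrite mulrC -ltr_pdivlMr.
  (* The first [j] coordinates are those of the projection of [z], the others those of the
     projection of [x]. *)
  pose b j : 'rV[R]_k := x *m p + \row_(i < k) (if (i < j)%N then w ord0 i else 0).
  have bw j : `|b j - x *m p| <= `|w|.
    rewrite /b addrAC subrr add0r; apply: rV_norm_leP => // i; rewrite mxE.
    by case: ifP => _; rewrite ?normr0// rV_coord_le_norm.
  have bd j : `|b j - x *m p| < d by exact: le_lt_trans (bw j) wd.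
  have sx : s (x *m p) = x by apply: sloc => //; rewrite subrr normr0.
  have xd : `|x *m p - x *m p| < d by rewrite subrr normr0.
  have sbx j : `|s (b j) - x| < mdel.
    rewrite -[X in _ - X]sx; apply: le_lt_trans (slip _ _ (bd j) xd) _.
    by apply: le_lt_trans wm; rewrite (ler_pM2l c0).
  have bS (j : 'I_k) : b j.+1 - b j = w ord0 j *: delta_mx ord0 j.
    apply/rowP => i; rewrite !mxE eqxx /= ltnS leq_eqVlt.
    have [->|ij] := eqVneq i j; first by rewrite eqxx ltnn /=; ring.
    by rewrite (inj_eq val_inj) (negbTE ij) /=; case: ifP => _; ring.
  have b0 : b 0%N = x *m p.
    by apply/rowP => i; rewrite !mxE addr0.
  have bk : b k = z *m p.
    apply/rowP => i; rewrite mxE [(\row_ _ _) _ _]mxE ltn_ord /w !mxE; ring.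
  have walk j : (j <= k)%N -> `|res (s (b j) - x)| <= j%:R * (e1 * (c * `|w|)).
    elim: j => [|j IH] jk.
      by rewrite b0 sx subrr /res !mul0mx subrr normr0 mul0r.
    have -> : res (s (b j.+1) - x) =
        res (s (b j.+1) - s (b j)) + res (s (b j) - x).
      by rewrite /res !mulmxBl; apply/rowP => i; rewrite !mxE; ring.
    rewrite -natr1 mulrDl mul1r [leRHS]addrC (le_trans (ler_normD _ _))//.
    rewrite lerD//; last exact: IH (ltnW jk).
    have [Xb1 br1 bE1] := Hs _ (bd j.+1); have [Xb br bE] := Hs _ (bd j).
    have pp : paratangent_pairs X x (del0 (Ordinal jk)) (s (b j.+1), s (b j)).
      by split => //=; exact: lt_le_trans (sbx _) (mdel_le _).
    apply: le_trans ((Hdel0 (Ordinal jk)).2 _ _ (w ord0 (Ordinal jk)) pp _) _.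
      by rewrite mulmxBl bE1 bE -bS.
    rewrite (ler_pM2l e10); apply: (le_trans (slip _ _ (bd _) (bd _))).
    rewrite (ler_pM2l c0) (bS (Ordinal jk)) normrZ norm_delta_mx mulr1.
    exact: rV_coord_le_norm.
  have := walk k (leqnn k); rewrite bk sloc// => /le_trans; apply.
  apply: (@le_trans _ _ (k%:R * (e1 * (c * (C * `|z - x|))))).
    by rewrite ler_wpM2l// (ler_pM2l e10) (ler_pM2l c0).
  have -> : k%:R * (e1 * (c * (C * `|z - x|))) = (k%:R * c * C * e1) * `|z - x|.
    by ring.
  rewrite ler_wpM2r// /e1 mulrA ler_pdivrMr// mulrC (ler_pM2l e0).
  by rewrite lerDl.
apply/eqP; rewrite -subr_eq0 -normr_le0 -/(res v).
apply: (@le0_mul_small _ _ (`|v| + 1 + (1 + D * C))) => e e0 e1.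
have [del del0 Hdel] := near e e0.
have m0 : 0 < Num.min e del by rewrite lt_min e0.
have [z [y' [t [[/= Xz -> zx] t0]]]] := Tv _ m0.
move: zx; rewrite !lt_min => /andP[zxe zxd] /andP[zve _].
have -> : res v = t *: res (z - x) - res (t *: (z - x) - v).
  have -> : res (t *: (z - x) - v) = t *: res (z - x) - res v.
    have resB w1 w2 : res (w1 - w2) = res w1 - res w2.
      by rewrite /res !mulmxBl !opprB !addrA; apply/rowP => j; rewrite !mxE; ring.
    by rewrite resB; congr (_ - _); rewrite /res -!scalemxAl [RHS]scalerBr.
  by rewrite opprB addrCA subrr addr0.
rewrite mulrDl (le_trans (ler_normB _ _))// lerD//.
  rewrite normrZ ger0_norm//; apply: (@le_trans _ _ (t * (e * `|z - x|))).
    by rewrite ler_wpM2l//; exact: Hdel.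
  rewrite mulrCA mulrC (ler_pM2r e0) -{1}(ger0_norm t0) -normrZ.
  rewrite -[t *: _](subrK v) addrC (le_trans (ler_normD _ _))// lerD2l.
  exact: le_trans (ltW zve) e1.
rewrite mulrDl mul1r (le_trans (ler_normB _ _))// lerD//; first exact: ltW.
rewrite (le_trans (uD _))// -mulrA (ler_pM2l D0) (le_trans (pC _))//.
by rewrite (ler_pM2l C0) ltW.
Qed.

(** The point [y] with partial derivatives need not be generic, so its cone is transported back to
    [x]. This turns [p] and [U] into [p'] and [u']; as [p'] is injective on the cone at [x] with the
    same minimal [k], the graph property holds for [p'] as well. *)
Lemma generic_linear_graph (R : realType) (m : nat) (X : set 'rV[R]_m)
    (x : 'rV[R]_m) (r0 : R) :
  X x -> 0 < r0 -> compact (X `&` [set y | `|y - x| <= r0]) ->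
  (forall v, pcone X x v -> tcone X x v) -> cone_homogeneous X x ->
  exists k (p : 'M[R]_(m, k)) (u : 'M[R]_(k, m)) r c d,
    [/\ (k <= m)%N, graph_near X x p r c d, u *m p = 1%:M &
      forall v, tcone X x v -> v = v *m p *m u].
Proof.
move=> Xx r00 cK gen hom.
pose P k := `[< exists q : 'M[R]_(m, k), injective_on_cone (tcone X x) q >].
have exP : exists k, P k.
  by exists m; apply/asboolP; exists 1%:M => v _; rewrite mulmx1.
have [k /asboolP[p tp] kmin] := ex_minnP exP.
have min k' (q : 'M[R]_(m, k')) : injective_on_cone (tcone X x) q -> (k <= k')%N.
  by move=> tq; apply: kmin; apply/asboolP; exists q.
have km : (k <= m)%N by apply: (min m 1%:M) => v _; rewrite mulmx1.
have [r [c [d gr]]] := generic_graph Xx r00 cK gen hom min tp.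
have [s [Hs slip sloc]] := graph_section gr.
have [r_gt0 c0 d0 biL surj] := gr.
have [C C0 pC] := mulmx_norm_bound p.
have [b [U [bd HU]]] := lipschitz_on_ball_partials d0 (ltW c0) slip.
pose y := s b; have [Xy yr yb] := Hs b bd.
(* Differentiate [s b *m p = b] along each axis. *)
have Up : U *m p = 1%:M.
  apply/row_matrixP => i; rewrite row_mul row1 -/y.
  apply/eqP; rewrite -subr_eq0 -normr_le0.
  apply: (@le0_mul_small _ _ C) => e e0 e1.
  have [del del0 H] := HU i e e0.
  pose h : R := Num.min (del / 2) ((d - `|b - x *m p|) / 2).
  have h0 : 0 < h by rewrite lt_min !divr_gt0// subr_gt0.
  have hdel : `|h| < del.
    rewrite gtr0_norm//; have : h <= del / 2 by rewrite ge_min lexx.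
    by move: del0; clear; lra.
  have hd : `|h| < d - `|b - x *m p|.
    have : h <= (d - `|b - x *m p|) / 2 by rewrite ge_min lexx orbT.
    rewrite gtr0_norm//; move: bd; clear; lra.
  have bh : `|b + h *: delta_mx ord0 i - x *m p| < d.
    rewrite addrAC (le_lt_trans (ler_normD _ _))//.
    rewrite normrZ norm_delta_mx mulr1; move: hd; clear; lra.
  have [_ _ sbh] := Hs _ bh.
  rewrite -(ler_pM2r h0) -{1}(gtr0_norm h0) mulrC -normrZ -mulrA.
  apply: (@le_trans _ _
    `|(s (b + h *: delta_mx ord0 i) - s b - h *: row i U) *m p|).
    rewrite !mulmxBl sbh yb -scalemxAl -normrN.
    suff -> : - (h *: (row i U *m p - delta_mx ord0 i)) =
      b + h *: delta_mx ord0 i - b - h *: (row i U *m p) by [].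
    by move: (row i U *m p) => q; apply/rowP => j; rewrite !mxE; ring.
  rewrite (le_trans (pC _))// (ler_pM2l C0).
  by apply: (le_trans (H h hdel)); rewrite gtr0_norm.
have expan v : tcone X y v -> `|v| <= c * `|v *m p|.
  apply: (@tcone_expansion _ _ _ X y v p (r - `|y - x|)).
  - by rewrite subr_gt0.
  - exact: ltW.
  - move=> z Xz zy; apply: biL => //.
    by have := ler_distD y z x; move: zy; clear; lra.
pose rho : R := Num.min (Num.min (r - `|y - x|) ((d - `|b - x *m p|) / C))
  (d - `|b - x *m p|).
have rho0 : 0 < rho by rewrite !lt_min !subr_gt0 yr bd divr_gt0 ?subr_gt0.
have rhor : rho <= r - `|y - x| by rewrite !ge_min lexx.
have rhoC : rho <= (d - `|b - x *m p|) / C by rewrite !ge_min lexx orbT.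
have rhod : rho <= d - `|b - x *m p| by rewrite !ge_min lexx orbT.
clearbody rho.
have line v i a : tcone X y v -> v *m p = a *: delta_mx ord0 i -> v = a *: row i U.
  apply: (@tcone_line _ _ _ X p s b _ _ rho c) => //.
  - exact: ltW.
  - by rewrite -normr_gt0 norm_delta_mx.
  - move=> z Xz zy; apply: sloc => //.
      by have := ler_distD y z x; move: zy rhor; rewrite -/y; clear; lra.
    have := ler_distD b (z *m p) (x *m p).
    have : `|z *m p - b| <= C * `|z - s b|.
      by rewrite -[X in _ - X]yb -mulmxBl.
    have : C * `|z - s b| < d - `|b - x *m p|.
      by rewrite mulrC -ltr_pdivlMr//; exact: lt_le_trans zy rhoC.
    by clear; lra.
  - move=> a1 a2 h1 h2; apply: slip.
      by have := ler_distD b a1 (x *m p); move: h1 rhod; clear; lra.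
    by have := ler_distD b a2 (x *m p); move: h2 rhod; clear; lra.
  - exact: HU.
have [T Tu HT] := hom y Xy.
pose p' := invmx T *m p; pose u' := U *m T.
have up' : u' *m p' = 1%:M by rewrite /u' /p' mulmxA mulmxK.
have back w : tcone X x w -> exists v, [/\ tcone X y v, w = v *m T & w *m p' = v *m p].
  move=> Tw; exists (w *m invmx T); split; rewrite ?mulmxKV// ?mulmxA//.
  by apply/HT; rewrite mulmxKV.
have tp' : injective_on_cone (tcone X x) p'.
  move=> w /back[v [Tv -> ->]] vp; have := expan v Tv.
  by rewrite vp normr0 mulr0 normr_le0 => /eqP ->; rewrite mul0mx.
have [r' [c' [d' gr']]] := generic_graph Xx r00 cK gen hom min tp'.
exists k, p', u', r', c', d'; split => //.
apply: (generic_tcone_linear Xx gen gr' up') => w i a /back[v [Tv -> ->]] va.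
by rewrite (line v i a Tv va) -scalemxAl row_mul.
Qed.

(** * Differentiable graphs *)

Definition has_derivative (R : realType) (k m : nat)
    (f : 'rV[R]_k -> 'rV[R]_m) (a : 'rV[R]_k) (D : 'M[R]_(k, m)) : Prop :=
  forall e : R, 0 < e -> exists2 del : R, 0 < del & forall h : 'rV[R]_k,
    `|h| < del -> `|f (a + h) - f a - h *m D| <= e * `|h|.

(** The cone at [y = s b] lies in a space of dimension at most [k], isomorphic through [T] to the
    row space of [u]. As [s] is defined on a whole ball, secants above each axis have limits in the
    cone, so [p] maps this space onto [R^k]. The inverse [D] is the derivative, since secants of the
    graph have no other limiting directions. *)
Lemma section_differentiable (R : realType) (m k : nat) (X : set 'rV[R]_m)
    (x : 'rV[R]_m) (p : 'M[R]_(m, k)) (u : 'M[R]_(k, m)) (r c d : R)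
    (s : 'rV[R]_k -> 'rV[R]_m) :
  cone_homogeneous X x -> graph_near X x p r c d ->
  (forall v, tcone X x v -> v = v *m p *m u) ->
  (forall b, `|b - x *m p| < d -> [/\ X (s b), `|s b - x| < r & s b *m p = b]) ->
  forall b, `|b - x *m p| < d -> exists D, has_derivative s b D.
Proof.
move=> hom gr lin Hs b bd; have [r0 c0 d0 biL surj] := gr.
have [C C0 pC] := mulmx_norm_bound p.
have slip h : `|b + h - x *m p| < d -> `|s (b + h) - s b| <= c * `|h|.
  move=> bh; have [X1 r1 e1] := Hs _ bh; have [X2 r2 e2] := Hs _ bd.
  apply: (le_trans (biL _ _ X1 X2 r1 r2)).
  by rewrite e1 e2 addrAC subrr add0r.
have bh h : `|h| < d - `|b - x *m p| -> `|b + h - x *m p| < d.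
  by move=> hd; rewrite addrAC (le_lt_trans (ler_normD _ _))//; move: hd; clear; lra.
pose y := s b; have [Xy yr yb] := Hs b bd.
have [T Tu HT] := hom y Xy.
pose py := T *m p; pose uy := u *m invmx T.
have liny v : tcone X y v -> v = v *m py *m uy.
  move=> /HT Tv; have := lin _ Tv => /(congr1 (mulmxr (invmx T))) /=.
  by rewrite mulmxK// /py /uy !mulmxA.
have expan v : tcone X y v -> `|v| <= c * `|v *m p|.
  apply: (@tcone_expansion _ _ _ X y v p (r - `|y - x|)).
  - by rewrite subr_gt0.
  - exact: ltW.
  - move=> z Xz zy; apply: biL => //.
    by have := ler_distD y z x; move: zy; clear; lra.
have near_s e h : 0 < e -> `|h| < Num.min (d - `|b - x *m p|) (e / c) ->
    h != 0 -> tangent_pairs X y e (s (b + h), y) /\ s (b + h) != y.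
  move=> e0; rewrite lt_min => /andP[hd he] h0.
  have [X1 r1 e1] := Hs _ (bh h hd); split.
    split => //=; apply: le_lt_trans (slip h (bh h hd)) _.
    by rewrite mulrC -ltr_pdivlMr.
  apply: contraNneq h0 => sy; apply/eqP.
  have : b + h = b by rewrite -e1 sy.
  by move=> /(congr1 (fun w => w - b)); rewrite addrAC subrr add0r.
have /choice[V HV] : forall i, exists v : 'rV[R]_m,
    v = v *m py *m uy /\ v *m p = delta_mx ord0 i.
  move=> i; pose f (w : 'rV[R]_m) :=
    w *m p - (w *m p) ord0 i *: (delta_mx ord0 i : 'rV[R]_k).
  have f_lip w w' : `|f w - f w'| <= (C + C) * `|w - w'|.
    have -> : f w - f w' = (w - w') *m p -
        ((w - w') *m p) ord0 i *: delta_mx ord0 i.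
      by rewrite /f mulmxBl; apply/rowP => j; rewrite !mxE; ring.
    rewrite mulrDl (le_trans (ler_normB _ _))// lerD//.
    rewrite normrZ norm_delta_mx mulr1.
    by rewrite (le_trans (rV_coord_le_norm _ _)).
  have cZ : closed [set w | f w = 0].
    apply: (@preimage_closed _ _ f [set 0]).
      by move=> w _; exact: (lipschitz_continuous f_lip).
    exact: (accessible_closed_set1 (hausdorff_accessible (@norm_hausdorff _ _))).
  (* Secants from [y] to points above the axis through [b] accumulate at a unit vector that projects
     to the axis. *)
  have [v [Tv v1 fv]] : exists v, [/\ tcone X y v, `|v| = 1 & f v = 0].
    apply: contrapT => nv.
    have [|e e0 He] := dircone_avoid (@tangent_pairs_mono _ _ X y) cZ.
      by move=> v Tv v1 fv; apply: nv; exists v.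
    pose M : R := Num.min (d - `|b - x *m p|) (e / c).
    have M0 : 0 < M by rewrite lt_min subr_gt0 bd divr_gt0.
    pose h : 'rV[R]_k := (M / 2) *: delta_mx ord0 i.
    have hn : `|h| = M / 2.
      by rewrite normrZ norm_delta_mx mulr1 gtr0_norm// divr_gt0.
    have hM : `|h| < M by rewrite hn; move: M0; clear; lra.
    have h0 : h != 0 by rewrite -normr_gt0 hn divr_gt0.
    have [tg ne] := near_s e h e0 hM h0; apply: (He _ _ tg ne) => /=.
    have hd : `|h| < d - `|b - x *m p|.
      by apply: lt_le_trans hM _; rewrite ge_min lexx.
    have [_ _ e1] := Hs (b + h) (bh h hd).
    rewrite /f -!scalemxAl mulmxBl yb e1 addrAC subrr add0r.
    by rewrite /h; apply/rowP => j; rewrite !mxE !eqxx /=; ring.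
  pose a := (v *m p) ord0 i.
  have va : v *m p = a *: delta_mx ord0 i by apply/eqP; rewrite -subr_eq0; apply/eqP.
  have a0 : a != 0.
    apply: contra_eq_neq v1 => a0; have := expan v Tv.
    rewrite va a0 scale0r normr0 mulr0 => v0.
    by rewrite lt_eqF// (le_lt_trans v0).
  exists (a^-1 *: v); split; first by rewrite -!scalemxAl -(liny v Tv).
  by rewrite -scalemxAl va scalerA mulVf// scale1r.
pose D : 'M[R]_(k, m) := \matrix_(i, j) V i ord0 j.
have rowD i : row i D = V i by apply/rowP => j; rewrite !mxE.
have Dp : D *m p = 1%:M.
  by apply/row_matrixP => i; rewrite row_mul rowD row1; have [] := HV i.
have Dlin : D = D *m py *m uy.
  by apply/row_matrixP => i; rewrite !row_mul rowD; have [] := HV i.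
(* Thus [D] and [uy] have the same row space, which contains the cone. *)
have Du : D *m py \in unitmx.
  suff /mulmx1_unit[] : (D *m py) *m (uy *m p) = 1%:M by [].
  by rewrite mulmxA -Dlin.
have uyE : invmx (D *m py) *m D = uy by rewrite [X in _ *m X]Dlin mulKmx.
have linD v : tcone X y v -> v = v *m p *m D.
  move=> Tv; have vE : v = v *m py *m invmx (D *m py) *m D.
    by rewrite -[RHS]mulmxA uyE -liny.
  by rewrite [X in X *m p]vE -[_ *m D *m p]mulmxA Dp mulmx1.
exists D => e e0; have [K K0 DK] := mulmx_norm_bound D.
pose res (w : 'rV[R]_m) := w - w *m p *m D.
have res_lip w w' : `|res w - res w'| <= (1 + K * C) * `|w - w'|.
  have -> : res w - res w' = (w - w') - (w - w') *m p *m D.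
    by rewrite /res !mulmxBl; apply/rowP => j; rewrite !mxE; ring.
  rewrite mulrDl mul1r (le_trans (ler_normB _ _))// lerD2l -mulrA.
  by rewrite (le_trans (DK _))// (ler_pM2l K0).
(* Secants have length at most [c * |h|], hence the division by [c]. *)
have ec0 : 0 < e / c by rewrite divr_gt0.
have cZ : closed [set w | e / c <= `|res w|].
  apply: (@preimage_closed _ _ (fun w => `|res w|) [set t | e / c <= t]);
    last exact: closed_ge.
  move=> w _; apply: (@lipschitz_continuous _ _ _ (1 + K * C)) => w1 w2.
  by rewrite (le_trans (ler_dist_dist _ _)).
have [|e1 e10 He1] := dircone_avoid (@tangent_pairs_mono _ _ X y) cZ.
  move=> v Tv _ /=; rewrite leNgt => /negP; apply.
  by rewrite /res -(linD v Tv) subrr normr0.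
exists (Num.min (d - `|b - x *m p|) (e1 / c)).
  by rewrite lt_min subr_gt0 bd divr_gt0.
move=> h hM; have [->|h0] := eqVneq h 0.
  by rewrite addr0 mul0mx !subrr !normr0 mulr0.
have [tg ne] := near_s e1 h e10 hM h0.
have hd : `|h| < d - `|b - x *m p| by move: hM; rewrite lt_min => /andP[].
have [_ _ sbh] := Hs _ (bh h hd).
have n0 : 0 < `|s (b + h) - y| by rewrite normr_gt0 subr_eq0.
have := He1 _ _ tg ne; rewrite /= => /negP; rewrite -ltNge.
have -> : res (`|s (b + h) - y|^-1 *: (s (b + h) - y)) =
    `|s (b + h) - y|^-1 *: res (s (b + h) - y).
  by rewrite /res -!scalemxAl [RHS]scalerBr.
rewrite normrZ normfV normr_id mulrC ltr_pdivrMr// => lt1.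
have -> : s (b + h) - s b - h *m D = res (s (b + h) - y).
  have hE : (s (b + h) - y) *m p = h.
    by rewrite mulmxBl sbh yb addrAC subrr add0r.
  by rewrite /res hE.
apply: (le_trans (ltW lt1)); apply: (@le_trans _ _ (e / c * (c * `|h|))).
  by rewrite (ler_pM2l ec0); exact: slip (bh h hd).
by rewrite mulrA divfK// gt_eqF.
Qed.

Lemma mulmxr_continuous (R : realType) (k m : nat) (D : 'M[R]_(k, m)) :
  continuous (mulmxr D : 'rV[R]_k -> 'rV[R]_m).
Proof.
have [C C0 DC] := mulmx_norm_bound D.
by apply: (@lipschitz_continuous _ _ _ C) => a b /=; rewrite -mulmxBl.
Qed.

Lemma mulmxr_differentiable (R : realType) (k m : nat) (D : 'M[R]_(k, m))
    (a : 'rV[R]_k) : differentiable (mulmxr D : 'rV[R]_k -> 'rV[R]_m) a.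
Proof. exact/linear_differentiable/mulmxr_continuous. Qed.

Lemma has_derivative_differentiable (R : realType) (k m : nat)
    (f : 'rV[R]_k -> 'rV[R]_m) (a : 'rV[R]_k) (D : 'M[R]_(k, m)) :
  has_derivative f a D -> differentiable f a.
Proof.
move=> fD; pose df : {linear 'rV[R]_k -> 'rV[R]_m} := mulmxr D.
have cdf : continuous df by exact: mulmxr_continuous.
have fE : f \o shift a =
    cst (f a) + (df : ('rV[R]_k : normedModType R) -> ('rV[R]_m : normedModType R))
    +o_ (0 : ('rV[R]_k : normedModType R)) id.
  apply/eqaddoP => e e0; have [del del0 H] := fD e e0.
  rewrite -nbhs_nearE nbhs_simpl /=; apply/nbhs_ballP; exists del => //= h.
  rewrite -ball_normE /ball_ /= sub0r normrN => hd.
  rewrite (le_trans _ (H h hd))// le_eqVlt; apply/orP; left; apply/eqP.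
  congr (`|_|); transitivity (f (h + a) - (f a + h *m D)) => //.
  by rewrite opprD addrA (addrC h).
have dE := diff_unique cdf fE.
by apply/diff_locallyP; rewrite dE.
Qed.

Lemma differentiable_has_derivative (R : realType) (k m : nat)
    (f : 'rV[R]_k -> 'rV[R]_m) (a : 'rV[R]_k) :
  differentiable f a -> exists D, has_derivative f a D.
Proof.
move=> fa; exists (lin1_mx ('d f a)) => e e0.
have /eqaddoP /(_ e e0) := diff_locally fa.
rewrite -nbhs_nearE nbhs_simpl /= => /nbhs_ballP[del /= del0 H].
exists del => // h hd; have := H h.
rewrite -ball_normE /ball_ /= sub0r normrN => /(_ hd) fh.
rewrite (le_trans _ fh)// le_eqVlt; apply/orP; left; apply/eqP.
congr (`|_|); transitivity (f (h + a) - (f a + 'd f a h)) => //.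
by rewrite opprD addrA (addrC h) mul_rV_lin1.
Qed.

Lemma has_derivative_bound (R : realType) (k m : nat)
    (f : 'rV[R]_k -> 'rV[R]_m) (a : 'rV[R]_k) (D : 'M[R]_(k, m)) :
  has_derivative f a D -> exists K del : R, [/\ 0 < K, 0 < del &
    forall h : 'rV[R]_k, `|h| < del -> `|f (a + h) - f a| <= K * `|h|].
Proof.
move=> /(_ 1 ltr01)[del del0 H]; have [C C0 DC] := mulmx_norm_bound D.
exists (1 + C), del; split; rewrite ?addr_gt0// => h hd.
rewrite -[f (a + h) - f a](subrK (h *m D)) mulrDl (le_trans (ler_normD _ _))//.
by rewrite lerD// H.
Qed.

(** The chain rule for [g \o f], the identity near [a], tested on small multiples of the basis
    vectors. *)
Lemma has_derivative_cancel (R : realType) (k m : nat)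
    (f : 'rV[R]_k -> 'rV[R]_m) (g : 'rV[R]_m -> 'rV[R]_k) (a : 'rV[R]_k)
    (D : 'M[R]_(k, m)) (E : 'M[R]_(m, k)) (rho : R) : 0 < rho ->
  (forall h : 'rV[R]_k, `|h| < rho -> g (f (a + h)) = a + h) ->
  has_derivative f a D -> has_derivative g (f a) E -> D *m E = 1%:M.
Proof.
move=> rho0 gf fD gE; apply/row_matrixP => i; rewrite row_mul row1.
have [K [del [K0 del0 HK]]] := has_derivative_bound fD.
have [C C0 EC] := mulmx_norm_bound E.
apply/eqP; rewrite -subr_eq0 -normr_le0.
apply: (@le0_mul_small _ _ (C + K)) => e e0 e1.
have [d1 d10 H1] := fD e e0; have [d2 d20 H2] := gE e e0.
pose t : R := Num.min (Num.min rho del) (Num.min d1 (d2 / K)) / 2.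
have t0 : 0 < t by rewrite divr_gt0// !lt_min rho0 del0 d10 divr_gt0.
have : `|t| < Num.min (Num.min rho del) (Num.min d1 (d2 / K)).
  by rewrite gtr0_norm// /t; move: t0; rewrite /t; clear; lra.
rewrite !lt_min => /andP[/andP[trho tdel] /andP[td1 td2]].
pose h : 'rV[R]_k := t *: delta_mx ord0 i.
have hn : `|h| = `|t| by rewrite normrZ norm_delta_mx mulr1.
have gfa : g (f a) = a by have := gf 0; rewrite normr0 addr0 => ->.
have h1 := H1 h; rewrite hn in h1; move/(_ td1) in h1.
have h3 : `|f (a + h) - f a| <= K * `|t| by have := HK h; rewrite hn; exact.
have h2 := H2 (f (a + h) - f a).
have h3' : `|f (a + h) - f a| < d2.
  by apply: le_lt_trans h3 _; rewrite mulrC -ltr_pdivlMr.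
have fE : f a + (f (a + h) - f a) = f (a + h) by rewrite addrC subrK.
move/(_ h3') in h2; rewrite fE gf ?hn// gfa in h2.
rewrite [a + h - a]addrAC subrr add0r in h2.
rewrite -(ler_pM2l t0) -{1}(gtr0_norm t0) -normrZ.
have -> : t *: (row i D *m E - delta_mx ord0 i) =
    - ((f (a + h) - f a - h *m D) *m E) - (h - (f (a + h) - f a) *m E).
  have -> : t *: (row i D *m E - delta_mx ord0 i) = h *m D *m E - h.
    by rewrite scalerBr /h -!scalemxAl -rowE.
  rewrite mulmxBl; move: (h *m D *m E) ((f (a + h) - f a) *m E) => q1 q2.
  by apply/rowP => j; rewrite !mxE; ring.
rewrite (le_trans (ler_normB _ _))// normrN mulrCA mulrDl lerD//.
  apply: (le_trans (EC _)); rewrite (ler_pM2l C0) (mulrC t).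
  by move: h1; rewrite (gtr0_norm t0).
apply: (le_trans h2); rewrite (mulrC t) mulrCA (ler_pM2l e0).
by move: h3; rewrite (gtr0_norm t0).
Qed.

Lemma tcone_has_derivative (R : realType) (k m : nat) (X : set 'rV[R]_k)
    (Y : set 'rV[R]_m) (f : 'rV[R]_k -> 'rV[R]_m) (a : 'rV[R]_k)
    (D : 'M[R]_(k, m)) (rho : R) : 0 < rho ->
  (forall z, X z -> `|z - a| < rho -> Y (f z)) -> has_derivative f a D ->
  forall v, tcone X a v -> tcone Y (f a) (v *m D).
Proof.
move=> rho0 XY fD v Tv e e0.
have [K [del [K0 del0 HK]]] := has_derivative_bound fD.
have [C C0 DC] := mulmx_norm_bound D.
(* As [t *: (z - a)] is bounded by [|v| + 1], the first-order error of [f], multiplied by [t], is at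
   most [e / 2]. *)
pose e1 : R := e / 2 / (`|v| + 1).
have v1 : 0 < `|v| + 1 by rewrite ltr_wpDl.
have e10 : 0 < e1 by rewrite !divr_gt0.
have [d1 d10 H1] := fD e1 e10.
pose d : R := Num.min (Num.min rho del)
  (Num.min (Num.min d1 (e / K)) (Num.min 1 (e / 2 / C))).
have d0 : 0 < d by rewrite !lt_min rho0 del0 d10 ltr01 !divr_gt0.
have [z [y' [t [[/= Xz -> za] t0 zv]]]] := Tv d d0.
move: za; rewrite !lt_min => /andP[/andP[zrho zdel] /andP[/andP[zd1 zK] _]].
move: zv; rewrite !lt_min => /andP[_ /andP[_ /andP[zv1 zvC]]].
have h1 := H1 (z - a) zd1; have h2 := HK (z - a) zdel.
have fE : a + (z - a) = z by rewrite addrC subrK.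
rewrite fE in h1 h2.
exists (f z), (f a), t; split => //.
  split => //=; first exact: XY.
  by apply: le_lt_trans h2 _; rewrite mulrC -ltr_pdivlMr.
have -> : t *: (f z - f a) - v *m D =
    t *: (f z - f a - (z - a) *m D) + (t *: (z - a) - v) *m D.
  have -> : (t *: (z - a) - v) *m D = t *: ((z - a) *m D) - v *m D.
    by rewrite [LHS]mulmxBl -scalemxAl.
  move: ((z - a) *m D) (v *m D) => q1 q2.
  by apply/rowP => j; rewrite !mxE; ring.
rewrite (le_lt_trans (ler_normD _ _))// [e]splitr.
apply: ler_ltD.
  rewrite normrZ (ger0_norm t0).
  apply: (@le_trans _ _ (t * (e1 * `|z - a|))); first by rewrite ler_wpM2l.
  rewrite mulrCA -{1}(ger0_norm t0) -normrZ.
  have tz1 : `|t *: (z - a)| <= `|v| + 1.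
    rewrite -[t *: _](subrK v) addrC (le_trans (ler_normD _ _))// lerD2l.
    exact: ltW.
  have -> : e / 2 = e1 * (`|v| + 1) by rewrite /e1 divfK// gt_eqF.
  by rewrite (ler_pM2l e10).
by rewrite (le_lt_trans (DC _))// mulrC -ltr_pdivlMr.
Qed.

(* The flattening is y |-> y - g (y p), where g a = s a - a u takes its values
   in the kernel of p, followed by a linear map sending the row space of u to
   the coordinate subspace. *)
Lemma flattening (R : realType) (m k : nat) (X : set 'rV[R]_m)
    (x : 'rV[R]_m) (p : 'M[R]_(m, k)) (u : 'M[R]_(k, m)) (r d : R)
    (s : 'rV[R]_k -> 'rV[R]_m) :
  (k <= m)%N -> 0 < r -> 0 < d -> u *m p = 1%:M ->
  (forall b, `|b - x *m p| < d -> [/\ X (s b), `|s b - x| < r & s b *m p = b]) ->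
  (forall z, X z -> `|z - x| < r -> `|z *m p - x *m p| < d -> s (z *m p) = z) ->
  (forall b, `|b - x *m p| < d -> exists D, has_derivative s b D) ->
  exists (U : set 'rV[R]_m) (phi psi : 'rV[R]_m -> 'rV[R]_m),
    [/\ open U /\ U x, open (phi @` U),
      forall y, U y -> psi (phi y) = y /\ differentiable phi y,
      forall z, (phi @` U) z -> differentiable psi z
    & phi @` (U `&` X) = phi @` U `&` @coordinate_subspace R m k].
Proof.
move=> km r0 d0 up Hs sloc sD.
(* In [u = col_ebase u *m pid_mx k *m row_ebase u] the last factor maps the coordinate subspace onto
   the row space of [u]; [B] undoes it. *)
pose B := invmx (row_ebase u).
have Bu : B \in unitmx by rewrite unitmx_inv row_ebase_unit.
pose g (a : 'rV[R]_k) := s a - a *m u.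
have gp a : `|a - x *m p| < d -> g a *m p = 0.
  move=> /Hs[_ _ sa]; rewrite /g mulmxBl sa -mulmxA up mulmx1 subrr; by [].
pose phi (y : 'rV[R]_m) := (y - g (y *m p)) *m B.
pose psi (z : 'rV[R]_m) := z *m invmx B + g (z *m invmx B *m p).
pose U : set 'rV[R]_m :=
  [set y | `|y - x| < r] `&` [set y | `|y *m p - x *m p| < d].
have phipE y : U y -> phi y *m invmx B *m p = y *m p.
  by move=> [_ yd]; rewrite /phi mulmxK// mulmxBl gp// subr0.
have psiphi y : U y -> psi (phi y) = y.
  by move=> Uy; rewrite /psi phipE// /phi mulmxK// subrK.
have phipsi z : `|z *m invmx B *m p - x *m p| < d -> phi (psi z) = z.
  move=> zd; rewrite /phi.
  have -> : psi z *m p = z *m invmx B *m p by rewrite /psi mulmxDl gp// addr0.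
  by rewrite /psi addrK mulmxKV.
have psip z : `|z *m invmx B *m p - x *m p| < d ->
    psi z *m p = z *m invmx B *m p.
  by move=> zd; rewrite /psi mulmxDl gp// addr0.
have gD a : `|a - x *m p| < d -> differentiable g a.
  move=> ad; have [D /has_derivative_differentiable sa] := sD a ad.
  apply: differentiableB => //; exact: (mulmxr_differentiable u a).
have phiD y : U y -> differentiable phi y.
  move=> [_ yd].
  apply: (@differentiable_comp _ _ _ _ (fun y => y - g (y *m p)) (mulmxr B));
    last exact: mulmxr_differentiable.
  apply: differentiableB; first exact: (@ex_diff _ _ _ _ _ id).
  apply: (@differentiable_comp _ _ _ _ (mulmxr p) g);
    [exact: mulmxr_differentiable|exact: gD].
have psiD z : `|z *m invmx B *m p - x *m p| < d -> differentiable psi z.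
  move=> zd; apply: differentiableD.
    exact: (mulmxr_differentiable (invmx B) z).
  apply: (@differentiable_comp _ _ _ _ (fun z => z *m invmx B *m p) g);
    last exact: gD.
  apply: (@differentiable_comp _ _ _ _ (mulmxr (invmx B)) (mulmxr p));
    exact: mulmxr_differentiable.
have openball (q : 'rV[R]_m -> R) (t : R) : continuous q ->
    open [set y | q y < t].
  by move=> cq; apply: (@open_comp _ _ q [set t' | t' < t]) => [v _|];
    [exact: cq|exact: open_lt].
have cnorm (j : nat) (A : 'M[R]_(m, j)) (v : 'rV[R]_j) :
    continuous (fun y : 'rV[R]_m => `|y *m A - v|).
  have [C C0 AC] := mulmx_norm_bound A.
  apply: (@lipschitz_continuous _ _ _ C) => y z.
  rewrite (le_trans (ler_dist_dist _ _))// opprB addrA subrK -mulmxBl; exact: AC.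
have oU : open U.
  apply: openI; last by apply: openball; exact: cnorm.
  by apply: openball => y; have := @cnorm m 1%:M x y; under eq_fun do rewrite mulmx1.
have Ux : U x by split; rewrite /= subrr normr0.
(* Described through [psi], the image is open by continuity of [psi] on the first of the two
   sets. *)
have imU : phi @` U = [set z | `|z *m invmx B *m p - x *m p| < d] `&`
    [set z | `|psi z - x| < r].
  apply/seteqP; split=> [_ [y Uy <-]|z [zd zr]].
    by split => /=; rewrite ?phipE ?psiphi//; case: Uy.
  exists (psi z); last exact: phipsi.
  by split => //=; rewrite psip.
exists U, phi, psi; split => //.
- rewrite imU openE => z [/= zd zr]; apply: filterI.
    apply: open_nbhs_nbhs; split => //; apply: openball => y.
    have := @cnorm k (invmx B *m p) (x *m p) y.
    by under eq_fun do rewrite mulmxA.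
  have cpsi : {for z, continuous (fun z => `|psi z - x|)}.
    apply: (@continuous_comp _ _ _ psi (fun y => `|y - x|)).
      exact: differentiable_continuous (psiD z zd).
    apply: (@lipschitz_continuous _ _ _ 1) => y1 y2.
    by rewrite mul1r (le_trans (ler_dist_dist _ _))// opprB addrA subrK.
  exact: (cvgr_lt `|psi z - x| cpsi).
- by move=> y Uy; split; [exact: psiphi|exact: phiD].
- by move=> z; rewrite imU => -[zd _]; exact: psiD.
have uk : \rank u = k.
  by apply/eqP/row_freeP; exists p.
have uE : u = col_ebase u *m pid_mx k *m row_ebase u.
  by have := mulmx_ebase u; rewrite uk => ->.
(* Both sides say that [w] lies in the row space of [u]. *)
have flat (w : 'rV[R]_m) :
    w = w *m p *m u <-> @coordinate_subspace R m k (w *m B).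
  split=> [wE i ki|wk].
    rewrite wE [X in _ *m X *m B]uE !mulmxA mulmxK ?row_ebase_unit//.
    by rewrite mxE big1// => j _; rewrite [pid_mx _ _ _]mxE; case: eqP => //= ji;
      rewrite ?mulr0//; move: (ltn_ord j); rewrite ji ltnNge ki.
  have wBE : w *m B = w *m B *m (pid_mx k : 'M[R]_(m, k)) *m pid_mx k.
    rewrite -[RHS]mulmxA pid_mx_id//; apply/rowP => i; rewrite [RHS]mxE.
    have [ik|ki] := ltnP i k.
      rewrite (bigD1 i)//= big1 ?addr0 => [|j ji].
        by rewrite [pid_mx _ _ _]mxE eqxx ik mulr1.
      by rewrite [pid_mx _ _ _]mxE; move: ji; rewrite -val_eqE /= => /negbTE ->;
        rewrite mulr0.
    rewrite wk// big1// => j _; rewrite [pid_mx _ _ _]mxE.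
    by case: eqP => [->|_]; rewrite ?(ltnNge i) ?ki /= ?mulr0.
  have [w' ww'] : exists w', w = w' *m u.
    exists (w *m B *m pid_mx k *m invmx (col_ebase u)).
    rewrite [X in _ *m X]uE !mulmxA mulmxKV ?col_ebase_unit// -wBE.
    by rewrite mulmxKV// row_ebase_unit.
  by rewrite {1 2}ww' -(mulmxA _ u) up mulmx1 -ww'.
apply/seteqP; split=> [_ [y [Uy Xy] <-]|_ [[y Uy <-] yk]].
  split; first by exists y.
  apply/flat; have [yr yd] := Uy.
  by rewrite /g sloc// opprB addrC subrK -!(mulmxA _ u) up mulmx1.
exists y => //; split => //; have [yr yd] := Uy.
(* This reads [y - g (y *m p) = y *m p *m u], that is [y = s (y *m p)], a point of [X]. *)
have /flat := yk; rewrite mulmxBl gp// subr0 /g opprB addrCA => /eqP.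
rewrite -subr_eq0 addrAC subrr add0r subr_eq0 => /eqP ->.
by have [] := Hs _ yd.
Qed.

(** * Charts and transport by homogeneity *)

(** In this form, [N] coincides inside [W] with a compact set, and so is closed near [x] when the
    space is Hausdorff. *)
Lemma locally_compact_subsetP (T : topologicalType) (N : set T) (x : T) :
  locally_compact_subset N -> N x -> exists W K : set T,
    [/\ open W, W x, compact K, K `<=` N & W `&` N `<=` K].
Proof.
move=> Nlc Nx; pose x' : set_type N := exist _ x (mem_set Nx).
have [U nU [cU _]] := Nlc x' Logic.I.
have : nbhs x' (fun t => [set: N] t -> U t) := nU.
rewrite nbhsE => -[V [[W oW WV] Vx] VU].
exists W, (set_val @` U); split => //.
- by move: Vx; rewrite -WV.
- apply: continuous_compact cU; apply: continuous_subspaceT.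
  exact: initial_continuous.
- by move=> _ [y _ <-]; exact: set_valP.
- move=> y [Wy Ny]; exists (exist _ y (mem_set Ny)) => //.
  by apply: VU => //; rewrite -WV.
Qed.

Lemma near_eq_differentiable (R : realType) (k m : nat)
    (f g : 'rV[R]_k -> 'rV[R]_m) (a : 'rV[R]_k) :
  (\forall z \near a, f z = g z) -> differentiable f a -> differentiable g a.
Proof.
move=> /nbhs_ballP[rho /= rho0 fg] /differentiable_has_derivative[D fD].
have fgE (h : 'rV[R]_k) : `|h| < rho -> f (a + h) = g (a + h).
  move=> hr; apply: fg; rewrite -ball_normE /ball_ /=.
  by rewrite opprD addrA subrr add0r normrN.
apply: (@has_derivative_differentiable _ _ _ _ _ D) => e e0.
have [del del0 H] := fD e e0; exists (Num.min del rho).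
  by rewrite lt_min del0.
move=> h; rewrite lt_min => /andP[hd hr]; rewrite -fgE//.
have := fgE 0; rewrite normr0 addr0 => /(_ rho0) <-; exact: H.
Qed.

(** The coordinate expression factors through a chart [c'] around [f x], but only near the point,
    where continuity of [f] keeps the values in the domain of [c']. *)
Lemma smooth_at_comp (R : realType) (T T' T'' : topologicalType)
    (m m' m'' : nat) (A : set (chart R T m)) (A' : set (chart R T' m'))
    (A'' : set (chart R T'' m'')) (f : T -> T') (g : T' -> T'') (x : T) :
  (exists2 c', A' c' & chart_dom c' (f x)) ->
  smooth_at A A' f x -> smooth_at A' A'' g (f x) -> smooth_at A A'' (g \o f) x.
Proof.
move=> [c' Ac' dc'] [cf df] [cg dg]; split.
  exact: continuous_comp cf cg.
move=> c c'' Ac Ac'' dx dgx.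
have fc := df c c' Ac Ac' dx dc'; have gc := dg c' c'' Ac' Ac'' dc' dgx.
have cK : chart_inv c (chart_map c x) = x by apply: chart_mapK; rewrite inE.
have := @differentiable_comp _ _ _ _ _
  (chart_map c'' \o g \o chart_inv c') (chart_map c x) fc.
rewrite /= cK => /(_ gc); apply: near_eq_differentiable.
have cinv : {for chart_map c x, continuous (f \o chart_inv c)}.
  apply: continuous_comp; last by rewrite cK.
  by apply: chart_inv_continuous; rewrite inE; exists x.
have : \forall z \near chart_map c x, chart_dom c' ((f \o chart_inv c) z).
  apply: cinv; rewrite /= cK.
  by apply: open_nbhs_nbhs; split => //; exact: chart_dom_open.
by apply: filterS => z /= dz; rewrite chart_mapK// inE.
Qed.

Lemma smooth_at_chart_map (R : realType) (m : nat) (M : smooth_manifold R m)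
    (c : chart R M m) (x : M) : atlas M c -> chart_dom c x ->
  smooth_at (atlas M) (@euclidean_atlas R m) (chart_map c) x.
Proof.
move=> Ac dx; split; first by apply: chart_map_continuous; rewrite inE.
move=> c1 c2 Ac1 -> dx1 _.
have [_ compat] := atlas_smooth M.
exact: compat c1 c x Ac1 Ac dx1 dx.
Qed.

Lemma smooth_at_chart_inv (R : realType) (m : nat) (M : smooth_manifold R m)
    (c : chart R M m) (z : 'rV[R]_m) : atlas M c -> (chart_map c @` chart_dom c) z ->
  smooth_at (@euclidean_atlas R m) (atlas M) (chart_inv c) z.
Proof.
move=> Ac zdom; split; first by apply: chart_inv_continuous; rewrite inE.
case: zdom => x dx <- c1 c2 -> Ac2 _.
have cK : chart_inv c (chart_map c x) = x by apply: chart_mapK; rewrite inE.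
rewrite cK => dx2; have [_ compat] := atlas_smooth M.
exact: compat c c2 x Ac Ac2 dx dx2.
Qed.

Lemma smooth_at_euclidean (R : realType) (m m' : nat)
    (f : 'rV[R]_m -> 'rV[R]_m') (z : 'rV[R]_m) : differentiable f z ->
  smooth_at (@euclidean_atlas R m) (@euclidean_atlas R m') f z.
Proof.
move=> fz; split; first exact: differentiable_continuous.
by move=> c c' -> ->.
Qed.

Lemma smooth_at_differentiable (R : realType) (m m' : nat)
    (f : 'rV[R]_m -> 'rV[R]_m') (z : 'rV[R]_m) :
  smooth_at (@euclidean_atlas R m) (@euclidean_atlas R m') f z ->
  differentiable f z.
Proof. by move=> [_ /(_ (euclidean_chart R m) (euclidean_chart R m'))]; exact. Qed.

(** The coordinate expressions of [h] and of its inverse preserve the set only near the base points,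
    which is enough for cones. Both are differentiable there, so their derivatives are inverse to
    each other. *)
Lemma cone_homogeneous_chart (R : realType) (m : nat) (M : smooth_manifold R m)
    (N : set M) (c : chart R M m) (V : set 'rV[R]_m) (x : 'rV[R]_m) :
  smoothly_ambient_homogeneous N -> atlas M c ->
  open V -> V `<=` chart_map c @` chart_dom c -> V x -> N (chart_inv c x) ->
  cone_homogeneous (V `&` (chart_inv c @^-1` N)) x.
Proof.
move=> Nh Ac oV Vc Vx Nx y [Vy Ny].
have [h [[hbij hsm [g gK gsm]] hyx hN]] := Nh _ _ Ny Nx.
have cinvK z : V z -> chart_map c (chart_inv c z) = z.
  by move=> /Vc[q dq <-]; rewrite chart_mapK// inE.
have cdom z : V z -> chart_dom c (chart_inv c z).
  by move=> /Vc[q dq <-]; rewrite chart_mapK// inE.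
have hg q : h (g q) = q.
  have [_ _ hsurj] := hbij; have [q' _ <-] := hsurj q Logic.I.
  by rewrite gK// inE.
have gh q : g (h q) = q by rewrite gK// inE.
have gyx : g (chart_inv c x) = chart_inv c y by rewrite -hyx gh.
have Nimh q : N q -> N (h q) by move=> Nq; rewrite -hN; exists q.
have Nimg q : N q -> N (g q) by rewrite -{1}hN => -[q' Nq' <-]; rewrite gh.
have local (F : M -> M) (a b : 'rV[R]_m) : V a -> V b ->
    F (chart_inv c a) = chart_inv c b ->
    smooth_at (atlas M) (atlas M) F (chart_inv c a) ->
    let H := chart_map c \o F \o chart_inv c in
    [/\ H a = b, differentiable H a & exists2 rho : R, 0 < rho & forall z,
      `|z - a| < rho -> [/\ V z, V (H z) & chart_inv c (H z) = F (chart_inv c z)]].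
  move=> Va Vb Fab Fsm H.
  have Hab : H a = b by rewrite /H /= Fab cinvK.
  have inva := smooth_at_chart_inv Ac (Vc _ Va).
  have cov q : exists2 c', atlas M c' & chart_dom c' q.
    by have [cover _] := atlas_smooth M; exact: cover.
  have FI := smooth_at_comp (cov _) inva Fsm.
  have dF : chart_dom c ((F \o chart_inv c) a) by rewrite /= Fab; exact: cdom.
  have HI : smooth_at (@euclidean_atlas R m) (@euclidean_atlas R m) H a.
    by apply: (smooth_at_comp (cov _) FI); exact: smooth_at_chart_map.
  split => //; first exact: smooth_at_differentiable.
  have [cFI _] := FI; have [cH _] := HI.
  have n1 : \forall z \near a, chart_dom c ((F \o chart_inv c) z).
    apply: cFI; apply: open_nbhs_nbhs; split => //; exact: chart_dom_open.
  have n2 : \forall z \near a, V (H z).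
    by apply: cH; apply: open_nbhs_nbhs; rewrite Hab.
  have n3 : \forall z \near a, V z by apply: open_nbhs_nbhs.
  have : nbhs a ([set z | chart_dom c ((F \o chart_inv c) z)] `&`
      ([set z | V (H z)] `&` V)).
    by apply: filterI => //; exact: filterI.
  move=> /nbhs_ballP[rho /= rho0 Hrho].
  exists rho => // z za; have [|/= z1 [z2 z3]] := Hrho z.
    by rewrite -ball_normE /ball_ /= distrC.
  by split => //; rewrite /H /= chart_mapK// inE.
have [Hyx Hd [rho rho0 Hrho]] := local h y x Vy Vx hyx (hsm _ Logic.I).
have [Gxy Gd [rho' rho'0 Grho]] := local g x y Vx Vy gyx (gsm _ Logic.I).
set H := _ \o _ in Hyx Hd Hrho; set G := _ \o _ in Gxy Gd Grho.
have [T HT] := differentiable_has_derivative Hd.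
have [S GS] := differentiable_has_derivative Gd.
have TS : T *m S = 1%:M.
  apply: (@has_derivative_cancel _ _ _ H G y T S rho) => // [k kr|].
    have [|Vz VH HE] := Hrho (y + k); first by rewrite addrAC subrr add0r.
    by rewrite /G /= HE gh cinvK.
  by rewrite Hyx.
have [Tu _] := mulmx1_unit TS.
exists T => // v; split.
  rewrite -Hyx; apply: (@tcone_has_derivative _ _ _ _ _ H y T rho) => //.
  move=> z [Vz Nz] /Hrho[_ VH HE]; split => //.
  by rewrite /preimage /= HE; exact: Nimh.
move=> Tv; have := @tcone_has_derivative _ _ _ _ (V `&` (chart_inv c @^-1` N))
  G x S rho' rho'0 _ GS _ Tv.
rewrite Gxy -mulmxA TS mulmx1; apply.
move=> z [Vz Nz] /Grho[_ VG GE]; split => //.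
by rewrite /preimage /= GE; exact: Nimg.
Qed.

Lemma smooth_at_continuous (R : realType) (T T' : topologicalType) (m m' : nat)
    (A : set (chart R T m)) (A' : set (chart R T' m')) (f : T -> T') (x : T) :
  smooth_at A A' f x -> {for x, continuous f}.
Proof. by case. Qed.

(** The flattening of [N] near [h x] is pulled back by [h]. Its domain is cut down to the points
    that [h] sends over [W], as the first inclusion is only assumed for those. *)
Lemma flattening_transport (R : realType) (m k : nat) (M : smooth_manifold R m)
    (N W : set M) (c : chart R M m) (U : set 'rV[R]_m)
    (phi psi : 'rV[R]_m -> 'rV[R]_m) (h g : M -> M) (x : M) :
  atlas M c -> open W -> open U -> open (phi @` U) ->
  (forall y, U y -> psi (phi y) = y /\ differentiable phi y) ->
  (forall z, (phi @` U) z -> differentiable psi z) ->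
  phi @` (U `&` [set y | (chart_map c @` (chart_dom c `&` W)) y /\
                         N (chart_inv c y)]) `<=` @coordinate_subspace R m k ->
  phi @` U `&` @coordinate_subspace R m k `<=`
    phi @` (U `&` [set y | N (chart_inv c y)]) ->
  cancel h g -> cancel g h ->
  (forall q, smooth_at (atlas M) (atlas M) h q) ->
  (forall q, smooth_at (atlas M) (atlas M) g q) ->
  h @` N = N ->
  chart_dom c (h x) -> W (h x) -> U (chart_map c (h x)) ->
  exists (U' : set M) (phi' : M -> 'rV[R]_m),
    [/\ open_nbhs x U',
        open (phi' @` U'),
        diffeomorphism (atlas M) (@euclidean_atlas R m) U' (phi' @` U') phi'
      & phi' @` (U' `&` N) = phi' @` U' `&` @coordinate_subspace R m k].
Proof.
move=> Ac oW oU oimU phiU psiD flat1 flat2 hK gK hsm gsm hN domx Wx Ux.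
pose f := chart_map c; pose f' := chart_inv c.
have fK q : chart_dom c q -> f' (f q) = q by move=> dq; apply: chart_mapK; rewrite inE.
pose P : set M := [set q | [/\ chart_dom c q, W q & U (f q)]].
pose U' : set M := h @^-1` P.
pose Phi := phi \o f \o h; pose Psi := g \o f' \o psi.
have PhiK q : U' q -> Psi (Phi q) = q.
  move=> [dq Wq Uq]; rewrite /Psi /Phi /=; have [-> _] := phiU _ Uq.
  by rewrite fK// hK.
have oP : open P.
  rewrite openE => q [dq Wq Uq].
  have n1 : nbhs q (chart_dom c).
    by apply: open_nbhs_nbhs; split => //; exact: chart_dom_open.
  have n2 : nbhs q W by apply: open_nbhs_nbhs.
  have n3 : \forall z \near q, U (f z).
    apply: (smooth_at_continuous (smooth_at_chart_map Ac dq)).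
    exact: open_nbhs_nbhs.
  near=> z; split; near: z; [exact: n1|exact: n2|exact: n3].
have oU' : open U'.
  apply: (@open_comp _ _ h P) => // q _; exact: smooth_at_continuous (hsm q).
pose V : set 'rV[R]_m := f @` (chart_dom c `&` W).
have VE z : V z <-> (f @` chart_dom c) z /\ W (f' z).
  split=> [[q [dq Wq] <-]|[[q dq <-]]]; first by split; [exists q|rewrite fK].
  by rewrite fK// => Wq; exists q.
have oV : open V.
  rewrite openE => z /VE[dz Wz].
  have n1 : nbhs z (f @` chart_dom c).
    by apply: open_nbhs_nbhs; split => //; exact: chart_img_open.
  have n2 : \forall w \near z, W (f' w).
    apply: (smooth_at_continuous (smooth_at_chart_inv Ac dz)).
    exact: open_nbhs_nbhs.
  near=> w; apply/VE; split; near: w; [exact: n1|exact: n2].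
have imE : Phi @` U' = [set z | (phi @` U) z /\ V (psi z)].
  apply/seteqP; split=> [_ [q [dq Wq Uq] <-]|_ [[y Uy <-]]].
    split; first by exists (f (h q)).
    by rewrite /Phi /=; have [-> _] := phiU _ Uq; exists (h q).
  have [-> _] := phiU _ Uy; move=> [q [dq Wq] qy].
  exists (g q); last by rewrite /Phi /= gK qy.
  by rewrite /U' /preimage /P /= gK; split => //; rewrite qy.
have oim : open (Phi @` U').
  rewrite imE openE => z [imz Vz].
  have n1 : nbhs z (phi @` U) by apply: open_nbhs_nbhs.
  have n2 : \forall w \near z, V (psi w).
    apply: (differentiable_continuous (psiD z imz)).
    exact: open_nbhs_nbhs.
  near=> w; split; near: w; [exact: n1|exact: n2].
have cov q : exists2 c', atlas M c' & chart_dom c' q.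
  by have [cover _] := atlas_smooth M; exact: cover.
have ecov z : exists2 c', @euclidean_atlas R m c' & chart_dom c' z.
  by exists (euclidean_chart R m).
have hyp q : U' q -> U (f (h q)) /\ V (f (h q)).
  by move=> [dq Wq Uq]; split => //; exists (h q).
exists U', Phi; split => //.
- split.
  + split=> [q Uq|q1 q2|z Uz]; first by exists q.
    * by rewrite !inE => U1 U2 /(congr1 Psi); rewrite !PhiK.
    * exact: Uz.
  + move=> q [dq Wq Uq]; apply: smooth_at_comp; first exact: cov.
      exact: hsm.
    apply: smooth_at_comp; first exact: ecov.
      exact: smooth_at_chart_map.
    by apply: smooth_at_euclidean; have [] := phiU _ Uq.
  + exists Psi; first by move=> q; rewrite inE; exact: PhiK.
    move=> z; rewrite imE => -[imz Vz]; apply: smooth_at_comp; first exact: ecov.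
      by apply: smooth_at_euclidean; exact: psiD.
    apply: smooth_at_comp; first exact: cov.
      by apply: smooth_at_chart_inv => //; have [] := (VE (psi z)).1 Vz.
    exact: gsm.
- apply/seteqP; split=> [_ [q [U'q Nq] <-]|_ [[q U'q <-]]].
    split; first by exists q.
    apply: flat1; exists (f (h q)) => //.
    have [Uq Vq] := hyp _ U'q; split => //; split => //.
    have [dq _ _] := U'q; rewrite -/f' fK//.
    by rewrite -hN; exists q.
  move=> cq; have [Uq Vq] := hyp _ U'q.
  have [//|y [Uy Ny] yq] := flat2 (Phi q).
    by split => //; exists (f (h q)).
  have yE : y = f (h q).
    by have [<- _] := phiU _ Uy; have [<- _] := phiU _ Uq; congr psi.
  have [dq _ _] := U'q; move: Ny; rewrite /= yE -/f' fK// -{1}hN => -[q' Nq' qq'].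
  exists q => //; split => //.
  by rewrite -(hK q) -qq' hK.
Unshelve. all: by end_near. Qed.

Theorem mainTheorem1 (R : realType) (m : nat) (M : smooth_manifold R m)
  (N : set M) (N_locally_compact : locally_compact_subset N)
  (N_homogeneous : smoothly_ambient_homogeneous N) :
  smooth_submanifold N.
Proof.
have [[x0 Nx0]|N0] := pselect (exists x, N x); last first.
  by exists 0%N => // x Nx; case: N0; exists x.
have [c Ac dx0] := (atlas_smooth M).1 x0.
have [W [K [oW Wx0 cK KN WNK]]] := locally_compact_subsetP N_locally_compact Nx0.
pose f := chart_map c; pose f' := chart_inv c.
have fK q : chart_dom c q -> f' (f q) = q.
  by move=> dq; apply: chart_mapK; rewrite inE.
pose V : set 'rV[R]_m := f @` (chart_dom c `&` W).
have VE z : V z <-> (f @` chart_dom c) z /\ W (f' z).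
  split=> [[q [dq Wq] <-]|[[q dq <-]]]; first by split; [exists q|rewrite fK].
  by rewrite fK// => Wq; exists q.
have f'cont z : V z -> {for z, continuous f'}.
  by move=> /VE[zd _]; apply: chart_inv_continuous; rewrite inE.
have oV : open V.
  rewrite openE => z Vz; have [dz Wz] := (VE z).1 Vz.
  have n1 : nbhs z (f @` chart_dom c).
    by apply: open_nbhs_nbhs; split => //; exact: chart_img_open.
  have n2 : \forall w \near z, W (f' w).
    by apply: (f'cont z Vz); exact: open_nbhs_nbhs.
  near=> w; apply/VE; split; near: w; [exact: n1|exact: n2].
pose z0 := f x0.
have Vz0 : V z0 by exists x0.
have [r0 r00 r0V] : exists2 r0 : R, 0 < r0 & forall z, `|z - z0| <= r0 -> V z.
  have : nbhs z0 V by exact: open_nbhs_nbhs.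
  move=> /nbhs_ballP[e /= e0 eV]; exists (e / 2); first by rewrite divr_gt0.
  move=> z ze; apply: eV; rewrite -ball_normE /ball_ /= distrC.
  by apply: le_lt_trans ze _; rewrite gtr_pMr// invf_lt1// ltr1n.
pose X := V `&` (f' @^-1` N).
have Xz0 : X z0 by split => //; rewrite /preimage /= /z0 fK.
(* Inside the ball, [X] is the preimage of the compact set [K]; this is where local compactness
   makes [X] closed. *)
have XK : X `&` [set y | `|y - z0| <= r0] =
    [set y | `|y - z0| <= r0] `&` (f' @^-1` K).
  apply/seteqP; split=> [y [[Vy Ny] yr]|y [yr Ky]].
    by split => //; apply: WNK; split => //; have [] := (VE y).1 Vy.
  by split => //; split; [exact: r0V|exact: KN].
have cX : compact (X `&` [set y | `|y - z0| <= r0]).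
  rewrite XK; apply: bounded_closed_compact.
    exists (`|z0| + r0); split; first exact: num_real.
    move=> L L0 z [/= zr _]; apply/ltW/(le_lt_trans _ L0).
    by have := ler_distD z0 z 0; rewrite !subr0 addrC => /le_trans->//; rewrite lerD2l.
  have clK : closed K by exact: compact_closed (@manifold_hausdorff _ _ M) cK.
  move=> z clz; have Bz : `|z - z0| <= r0.
    by apply: (@closed_norm_ball _ _ z0 r0) => U /clz[w [[Bw _] Uw]]; exists w.
  split => //; apply: contrapT => nKz.
  have : nbhs (f' z) (~` K) by apply: open_nbhs_nbhs; split => //; exact: closed_openC.
  move=> /(f'cont z (r0V z Bz)) /clz[w [[_ Kw] nKw]]; exact: nKw.
have [x [Xx xr px]] := generic_point Xz0 r00 cX.
pose r1 := r0 - `|x - z0|.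
have r10 : 0 < r1 by rewrite subr_gt0.
have cX1 : compact (X `&` [set y | `|y - x| <= r1]).
  by apply: compact_sub_ball cX _; rewrite /r1 addrC subrK.
have [Vx Nx] := Xx.
have Vc : V `<=` chart_map c @` chart_dom c by move=> z /VE[].
have hom : cone_homogeneous X x by exact: cone_homogeneous_chart.
have [k [p [u [r [cc [d [km gn upK lin]]]]]]] :=
  generic_linear_graph Xx r10 cX1 px hom.
have [r_gt0 _ d_gt0 _ _] := gn.
have [s [Hs _ sloc]] := graph_section gn.
have sD := section_differentiable hom gn lin Hs.
have [U [phi [psi [[oU Ux] oimU phiU psiD flat]]]] :=
  flattening km r_gt0 d_gt0 upK Hs sloc sD.
exists k => // q Nq.
have [h [[[_ hinj hsurj] hsm [g gK gsm]] hq hN]] := N_homogeneous _ _ Nq Nx.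
have [dx Wx] := (VE x).1 Vx.
have hqd : chart_dom c (h q) by rewrite hq; case: dx => w dw <-; rewrite -/f' fK.
have fhq : f (h q) = x by rewrite hq; case: dx => w dw <-; rewrite -/f' fK.
have hK : cancel h g by move=> w; rewrite gK// inE.
have gh : cancel g h by move=> w; have [w' _ <-] := hsurj w Logic.I; rewrite hK.
apply: (@flattening_transport _ _ _ _ _ W c U phi psi h g q) => //.
- by rewrite flat; exact: subIsetr.
- rewrite -flat => _ [y [Uy [_ Ny]] <-]; exists y => //.
- by move=> w; exact: hsm.
- by move=> w; exact: gsm.
- by rewrite hq.
- by rewrite -/f fhq.
Unshelve. all: by end_near. Qed.
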